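(* Let $B_1=\operatorname{Spec}\mathbf{Z}[1/2,b_2,b_4,b_6,\Delta^{-1}]$, with $\Delta=\frac{b_2^2(b_4^2-b_2b_6)}{4}-8b_4^3-27b_6^2+9b_2b_4b_6$, let $X_1$ be the elliptic curve $y^2=x^3+\frac{b_2}{4}x^2+\frac{b_4}{2}x+\frac{b_6}{4}$ over $B_1$, and let $\omega_1=\frac{dx}{2y}$, $\eta_1=x\frac{dx}{2y}$. Then the Ramanujan vector field $v_{11}$ over $B_1$ is $$v_{11}=2b_4\frac{\partial}{\partial b_2}+3b_6\frac{\partial}{\partial b_4}+(b_2b_6-b_4^2)\frac{\partial}{\partial b_6}.$$ Moreover, under the isomorphism $B_1\otimes_{\mathbf{Z}[1/2]}\mathbf{Z}[1/6]\cong\operatorname{Spec}\mathbf{Z}[1/6,e_2,e_4,e_6,(e_4^3-e_6^2)^{-1}]$ given by $e_2=b_2$, $e_4=b_2^2-24b_4$, $e_6=b_2^3-36b_2b_4+216b_6$, the vector field $v_{11}$ is identified with the vector field associated to the classical Ramanujan equations: $$\frac{e_2^2-e_4}{12}\frac{\partial}{\partial e_2}+\frac{e_2e_4-e_6}{3}\frac{\partial}{\partial e_4}+\frac{e_2e_6-e_4^2}{2}\frac{\partial}{\partial e_6}.$$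
   Context: Let $\nabla$ be the Gauss-Manin connection on $H^1_{\rm dR}(X_1/B_1)$ (relative to $\mathbf{Z}[1/2]$). The differentials $\omega_1,\eta_1$ of the second kind are identified with their classes, which form a basis of $H^1_{\rm dR}(X_1/B_1)$. $(X_1,(\omega_1,\eta_1))$ is the universal elliptic curve with symplectic-Hodge basis over $\mathbf{Z}[1/2]$-schemes. The Ramanujan vector field $v_{11}$ is the unique global section $v$ of $T_{B_1/\mathbf{Z}[1/2]}$ such that $\nabla_{v}\omega_1=\eta_1$ and $\nabla_{v}\eta_1=0$. *)

(* Defs.v *)
From HB Require Import structures.
From mathcomp Require Import all_boot all_order all_algebra.
From mathcomp Require Import generic_quotient ring_quotient.
From mathcomp Require Import mpoly.
From mathcomp Require Import boolp.
From mathcomp Require Import ring.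

Set Implicit Arguments.
Unset Strict Implicit.
Unset Printing Implicit Defensive.

Import GRing.Theory.
Local Open Scope ring_scope.
Local Open Scope quotient_scope.

Definition proper_gen (S : comNzRingType) (F : S) := ~ exists q : S, q * F = 1.

Section PrincipalQuotient.
Variables (S : comNzRingType) (F : S) (pF : proper_gen F).

Definition principal of proper_gen F : {pred S} :=
  fun a => `[< exists q : S, a = q * F >].

Lemma principal_idealr_closed : idealr_closed (principal pF).
Proof.
split; first by apply/asboolP; exists 0; rewrite mul0r.
  by apply/negP => /asboolP [q Eq]; apply: pF; exists q.
move=> a u v /asboolP [p ->] /asboolP [q ->]; apply/asboolP.
by exists (a * p + q); rewrite mulrDl mulrA.
Qed.

HB.instance Definition _ :=
  isIdealr.Build S (principal pF) principal_idealr_closed.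

Definition pquot : comNzRingType := {ideal_quot (principal pF)}.

Definition cls : {rmorphism S -> pquot} := \pi_{ideal_quot (principal pF)}.

Lemma cls_eq (a b : S) : cls a = cls b <-> exists q, a - b = q * F.
Proof.
split=> [/eqP|[q Eq]].
  by rewrite -Quotient.idealrBE => /asboolP.
by apply/eqP; rewrite -Quotient.idealrBE; apply/asboolP; exists q.
Qed.

Lemma cls_repr (a : pquot) : cls (repr a) = a.
Proof. exact: reprK. Qed.

Lemma cls_gen : cls F = 0.
Proof. by rewrite -(rmorph0 cls); apply/cls_eq; exists 1; rewrite subr0 mul1r. Qed.

Section Lift.
Variables (C : comNzRingType) (f : {rmorphism S -> C}) (fF : f F = 0).

Definition lift_fun of f F = 0 := fun a : pquot => f (repr a).

Lemma lift_cls (a : S) : lift_fun fF (cls a) = f a.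
Proof.
rewrite /lift_fun; have /cls_eq [q Eq] := cls_repr (cls a).
by apply/eqP; rewrite -subr_eq0 -rmorphB Eq rmorphM fF mulr0.
Qed.

Lemma lift_is_zmod_morphism : zmod_morphism (lift_fun fF).
Proof.
by move=> a b; rewrite -(cls_repr a) -(cls_repr b) -rmorphB !lift_cls rmorphB.
Qed.

Lemma lift_is_monoid_morphism : monoid_morphism (lift_fun fF).
Proof.
split; first by rewrite -(rmorph1 cls) lift_cls rmorph1.
by move=> a b; rewrite -(cls_repr a) -(cls_repr b) -rmorphM !lift_cls rmorphM.
Qed.

HB.instance Definition _ :=
  GRing.isZmodMorphism.Build pquot C (lift_fun fF) lift_is_zmod_morphism.
HB.instance Definition _ :=
  GRing.isMonoidMorphism.Build pquot C (lift_fun fF) lift_is_monoid_morphism.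

Definition lift : {rmorphism pquot -> C} := lift_fun fF.

Lemma liftE (a : S) : lift (cls a) = f a.
Proof. exact: lift_cls. Qed.

End Lift.
End PrincipalQuotient.

Lemma proper_gen_hom (S C : comNzRingType) (f : {rmorphism S -> C}) (F : S) :
  f F = 0 -> proper_gen F.
Proof.
move=> fF [q Eq]; have := rmorph1 f.
by rewrite -Eq rmorphM fF mulr0 => /eqP; rewrite eq_sym oner_eq0.
Qed.

(* The morphism A[X] -> C extending g and sending 'X to u. *)
Definition ev (A C : comNzRingType) (g : {rmorphism A -> C}) (u : C) :
  {rmorphism {poly A} -> C} := horner_morph (fun a => mulrC u (g a)).

Lemma evC (A C : comNzRingType) (g : {rmorphism A -> C}) u a :
  ev g u a%:P = g a.
Proof. exact: horner_morphC. Qed.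

Lemma evX (A C : comNzRingType) (g : {rmorphism A -> C}) u : ev g u 'X = u.
Proof. exact: horner_morphX. Qed.

Section EvMorph.
Variables (A C : comNzRingType) (g : {rmorphism A -> C}) (u : C).
Implicit Types p q : {poly A}.

Lemma evD p q : ev g u (p + q) = ev g u p + ev g u q.
Proof. exact: rmorphD. Qed.

Lemma evB p q : ev g u (p - q) = ev g u p - ev g u q.
Proof. exact: rmorphB. Qed.

Lemma evM p q : ev g u (p * q) = ev g u p * ev g u q.
Proof. exact: rmorphM. Qed.

Lemma evXn n : ev g u ('X ^+ n) = u ^+ n.
Proof. by rewrite rmorphXn evX. Qed.

Lemma ev_uniq (f : {rmorphism {poly A} -> C}) :
  (forall a, f a%:P = g a) -> f 'X = u -> forall p, f p = ev g u p.
Proof.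
move=> fC fX; elim/poly_ind => [|p a IH]; first by rewrite !rmorph0.
by rewrite evD evM evC evX -IH rmorphD rmorphM fC fX.
Qed.

End EvMorph.

Definition loc_rel (A : comNzRingType) (s : A) : {poly A} := s%:P * 'X - 1.

Lemma ev_loc_rel (A C : comNzRingType) (g : {rmorphism A -> C}) (s : A) u :
  g s * u = 1 -> ev g u (loc_rel s) = 0.
Proof. by move=> gs; rewrite rmorphB rmorphM rmorph1 evC evX gs subrr. Qed.

Definition derivation (A : comNzRingType) (M : lmodType A) (dl : A -> M) :=
  (forall a b, dl (a + b) = dl a + dl b) /\
  (forall a b, dl (a * b) = a *: dl b + b *: dl a).

Section Localization.
Variables (A : comNzRingType) (s : A) (ps : proper_gen (loc_rel s)).

Definition loc : comNzRingType := pquot ps.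

Definition inloc : {rmorphism A -> loc} := cls ps \o polyC.
Definition locinv : loc := cls ps 'X.

Lemma mul_locinv : inloc s * locinv = 1.
Proof.
rewrite -(rmorph1 (cls ps)) /inloc /locinv /= -rmorphM.
by apply/cls_eq; exists 1; rewrite mul1r.
Qed.

(* The extension of a derivation dl of A to A[1/s], computed on a polynomial  *)
(* representative p(T): p^dl(T) + p'(T) * dl(1/s), dl(1/s) = - T^2 dl(s).     *)
Definition loc_der (dl : A -> A) (a : loc) : loc :=
  cls ps (map_poly dl (repr a))
  + cls ps (repr a)^`() * (- locinv ^+ 2 * inloc (dl s)).

Section LocDer.
Variables (dl : A -> A) (dlP : @derivation A A^o dl).

Let dlD a b : dl (a + b) = dl a + dl b. Proof. exact: dlP.1. Qed.
Let dlM a b : dl (a * b) = a * dl b + b * dl a. Proof. exact: dlP.2. Qed.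

Let dl0 : dl 0 = 0.
Proof. by have /eqP := dlD 0 0; rewrite addr0 -subr_eq subrr => /eqP. Qed.

Let dl1 : dl 1 = 0.
Proof.
by have /eqP := dlM 1 1; rewrite !mul1r -subr_eq subrr => /eqP.
Qed.

Let dlN a : dl (- a) = - dl a.
Proof. by apply/eqP; rewrite -addr_eq0 -dlD addNr dl0. Qed.

Let dl_sum n (F : 'I_n -> A) : dl (\sum_(i < n) F i) = \sum_(i < n) dl (F i).
Proof. exact: (big_morph dl dlD dl0). Qed.

Let mapD p q : map_poly dl (p + q) = map_poly dl p + map_poly dl q.
Proof. by apply/polyP => i; rewrite coefD !coef_map_id0 // coefD dlD. Qed.

Let mapM p q :
  map_poly dl (p * q) = p * map_poly dl q + q * map_poly dl p.
Proof.
apply/polyP => i; rewrite [q * _]mulrC coefD !coef_map_id0 // !coefM dl_sum.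
rewrite -big_split; apply: eq_bigr => j _ /=.
by rewrite !coef_map_id0 // dlM [q`__ * _]mulrC.
Qed.

Let mapC a : map_poly dl a%:P = (dl a)%:P.
Proof. by apply/polyP => i; rewrite coef_map_id0 // !coefC; case: eqP. Qed.

Let mapX : map_poly dl 'X = 0.
Proof.
by apply/polyP => i; rewrite coef_map_id0 // coefX coef0; case: eqP.
Qed.

Let mapN p : map_poly dl (- p) = - map_poly dl p.
Proof. by apply/polyP => i; rewrite coefN !coef_map_id0 // coefN dlN. Qed.

Let T := - locinv ^+ 2 * inloc (dl s).
Let e p := cls ps (map_poly dl p) + cls ps p^`() * T.

Let eD p q : e (p + q) = e p + e q.
Proof. by rewrite /e mapD derivD !rmorphD mulrDl addrACA. Qed.

Let eM p q : e (p * q) = cls ps p * e q + cls ps q * e p.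
Proof. rewrite /e mapM derivM !rmorphD /= !rmorphM; ring. Qed.

Let e_rel : e (loc_rel s) = 0.
Proof.
rewrite /e /loc_rel mapD mapN mapM mapC mapX mapC dl1 mulr0 add0r oppr0 addr0.
rewrite derivB derivM !derivC derivX mul0r add0r mulr1 subr0 /T rmorphM.
have -> : cls ps s%:P * (- locinv ^+ 2 * inloc (dl s)) =
          - (inloc s * locinv) * (locinv * inloc (dl s)).
  by rewrite expr2 !mulNr mulrN !mulrA.
by rewrite mul_locinv mulN1r subrr.
Qed.

Let loc_der_cls p : loc_der dl (cls ps p) = e p.
Proof.
have /cls_eq [q Eq] := cls_repr (cls ps p).
rewrite -[LHS]/(e (repr (cls ps p))) -[repr _](subrK p) Eq eD eM e_rel cls_gen.
by rewrite mulr0 mul0r addr0 add0r.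
Qed.

Lemma loc_derP :
  @derivation loc loc^o (loc_der dl) /\
  forall a, loc_der dl (inloc a) = inloc (dl a).
Proof.
split; last first.
  by move=> a; rewrite [LHS]loc_der_cls /e mapC derivC rmorph0 mul0r addr0.
split=> a b; rewrite -(cls_repr a) -(cls_repr b).
  by rewrite -rmorphD !loc_der_cls eD.
by rewrite -rmorphM !loc_der_cls eM.
Qed.

End LocDer.
End Localization.

Lemma loc_properP (A : comNzRingType) (K : fieldType) (g : {rmorphism A -> K})
  (s : A) : g s != 0 -> proper_gen (loc_rel s).
Proof. by move=> /mulfV gs; apply: proper_gen_hom (ev_loc_rel gs). Qed.

Lemma loc_point (A : comNzRingType) (K : fieldType) (s : A)
    (ps : proper_gen (loc_rel s)) (g : {rmorphism A -> K}) : g s != 0 ->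
  exists2 f : {rmorphism loc ps -> K},
    forall a, f (inloc ps a) = g a & f (locinv ps) = (g s)^-1.
Proof.
move=> /mulfV gs; exists (lift ps (ev_loc_rel gs)).
  by move=> a; rewrite /inloc liftE evC.
by rewrite /locinv liftE evX.
Qed.

Definition rel_derivation (R A : comNzRingType) (f : R -> A) (M : lmodType A)
    (dl : A -> M) :=
  derivation dl /\ forall r, dl (f r) = 0.

(* Global vector fields on Spec A relative to Spec R: R-derivations A -> A.   *)
Definition vector_field (R A : comNzRingType) (f : R -> A) (v : A -> A) :=
  @rel_derivation R A f A^o v.

(* An element sum_i a_i d(b_i) of Omega^1_{A/R} is given by the list of pairs *)
(* (a_i, b_i).  As Hom_A(Omega^1_{A/R}, M) = Der_R(A, M) for every M, two     *)
(* such sums are equal in Omega^1_{A/R} exactly when every R-derivation of A  *)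
(* takes the same value on them.                                              *)
Definition form (A : Type) := seq (A * A).

Definition form_val (A : comNzRingType) (M : lmodType A) (dl : A -> M)
  (s : form A) : M := \sum_(p <- s) p.1 *: dl p.2.

Definition form_eq (R A : comNzRingType) (f : R -> A) (s s' : form A) :=
  forall (M : lmodType A) (dl : A -> M), rel_derivation f dl ->
    form_val dl s = form_val dl s'.

Definition form_d (A : comNzRingType) (g : A) : form A := [:: (1, g)].

Definition form_map (A B : Type) (g : A -> B) (s : form A) : form B :=
  [seq (g p.1, g p.2) | p <- s].

(* Lie derivative of a relative form along a derivation of A preserving R:    *)
(* L_D (a db) = D(a) db + a d(D b).                                           *)
Definition lie (A : Type) (D : A -> A) (s : form A) : form A :=
  [seq (D p.1, p.2) | p <- s] ++ [seq (p.1, D p.2) | p <- s].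

(* A scheme over Spec R glued from the affine schemes Spec U and Spec V along *)
(* the common affine open subscheme Spec W.                                   *)
Record two_charts (R : comNzRingType) := TwoCharts {
  chU : comNzRingType; chV : comNzRingType; chW : comNzRingType;
  strU : {rmorphism R -> chU};
  strV : {rmorphism R -> chV};
  strW : {rmorphism R -> chW};
  resU : {rmorphism chU -> chW};
  resV : {rmorphism chV -> chW};
  resU_str : forall r, resU (strU r) = strW r;
  resV_str : forall r, resV (strV r) = strW r }.

Section DeRham.
Variables (R : comNzRingType) (X : two_charts R).

(* Degree-one cochains of the Cech-de Rham complex.  The relative dimension   *)
(* is one, so there are no relative 2-forms and being a cocycle reduces to    *)
(* alpha - beta = dh on the overlap.                                          *)
Record cochain := Cochain {
  onU : form (chU X); onV : form (chV X); onW : chW X }.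

Definition cocycle (z : cochain) :=
  form_eq (strW X) (form_map (resU X) (onU z))
    (form_map (resV X) (onV z) ++ form_d (onW z)).

Definition cohomologous (z z' : cochain) :=
  exists (g : chU X) (h : chV X),
    [/\ form_eq (strU X) (onU z) (onU z' ++ form_d g),
        form_eq (strV X) (onV z) (onV z' ++ form_d h)
      & onW z = onW z' + (resU X g - resV X h)].

Definition cochain0 := Cochain [::] [::] 0.

(* [z'] = nabla_v [z]: with DU, DV liftings of v to the two charts and DWU,   *)
(* DWV their restrictions to the overlap, nabla_v of the class of             *)
(* (alpha, beta, h) is the class of                                           *)
(*   (L_DU alpha, L_DV beta, DWU h + <DWU - DWV, beta>)                       *)
(* (the Katz-Oda connection computed on Cech cochains).                       *)
Definition gauss_manin (v : R -> R) (z z' : cochain) :=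
  exists (DU : chU X -> chU X) (DV : chV X -> chV X) (DWU DWV : chW X -> chW X),
    [/\ [/\ @derivation _ (chU X)^o DU, @derivation _ (chV X)^o DV,
            @derivation _ (chW X)^o DWU & @derivation _ (chW X)^o DWV],
        (forall r, DU (strU X r) = strU X (v r)) /\
        (forall r, DV (strV X r) = strV X (v r)),
        (forall a, DWU (resU X a) = resU X (DU a)) /\
        (forall b, DWV (resV X b) = resV X (DV b))
      & cohomologous
          (Cochain (lie DU (onU z)) (lie DV (onV z))
             (DWU (onW z) +
              @form_val _ (chW X)^o (fun c => DWU c - DWV c)
                (form_map (resV X) (onV z))))
          z'].

(* For a differential of the second kind theta on X with no pole on Spec U    *)
(* (given by its restriction to Spec W): write theta = beta + dh with beta    *)
(* regular on Spec V and h in W; then (theta, beta, h) represents its class.  *)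
Definition second_kind_class (theta : form (chW X)) (z : cochain) :=
  cocycle z /\ form_eq (strW X) (form_map (resU X) (onU z)) theta.

End DeRham.

(* In {poly {poly A}} the inner variable is 'X%:P and the outer one is 'X.    *)
Definition ev2 (A C : comNzRingType) (g : {rmorphism A -> C}) (u v : C) :
  {rmorphism {poly {poly A}} -> C} := ev (ev g u) v.

Lemma ev2_comp (A B C : comNzRingType) (f : {rmorphism B -> C})
    (g : {rmorphism A -> B}) u v p :
  f (ev2 g u v p) = ev2 (f \o g) (f u) (f v) p.
Proof.
apply: (ev_uniq (f := f \o ev2 g u v)) => [q|] /=; last by rewrite /ev2 evX.
rewrite /ev2 evC.
by apply: (ev_uniq (f := f \o ev g u)) => [a|] /=; rewrite ?evC ?evX.
Qed.

(* The affine part Z <> 0 of Y^2 Z = X^3 + a2 X^2 Z + a4 X Z^2 + a6 Z^3, in   *)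
(* the coordinates x = X/Z (inner) and y = Y/Z (outer).                       *)
Definition weierU (R : comNzRingType) (a2 a4 a6 : R) : {poly {poly R}} :=
  'X ^+ 2 - ('X ^+ 3 + a2%:P * 'X ^+ 2 + a4%:P * 'X + a6%:P)%:P.

(* The affine part Y <> 0, in the coordinates w = Z/Y (inner) and t = X/Y     *)
(* (outer); it contains the point at infinity (t, w) = (0, 0).                *)
Definition weierV (R : comNzRingType) (a2 a4 a6 : R) : {poly {poly R}} :=
  'X ^+ 3 + (a2%:P * 'X)%:P * 'X ^+ 2 + (a4%:P * 'X ^+ 2)%:P * 'X
  + (a6%:P * 'X ^+ 3 - 'X)%:P.

Section WeierstrassEval.
Variables (R C : comNzRingType) (g : {rmorphism R -> C}) (a2 a4 a6 : R).

Lemma ev2_weierU x y :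
  ev2 g x y (weierU a2 a4 a6) =
  y ^+ 2 - (x ^+ 3 + g a2 * x ^+ 2 + g a4 * x + g a6).
Proof. by rewrite /weierU /ev2 evB evXn evC !evD !evM ?evXn ?evX !evC. Qed.

Lemma ev2_weierV w t :
  ev2 g w t (weierV a2 a4 a6) =
  t ^+ 3 + g a2 * w * t ^+ 2 + g a4 * w ^+ 2 * t + (g a6 * w ^+ 3 - w).
Proof.
by rewrite /weierV /ev2 !evD !evM ?evXn ?evX !evC evB !evM ?evXn ?evX !evC.
Qed.

(* On the overlap, t = x/y and w = 1/y. *)
Lemma ev2_weierUV x y T :
  ev2 g x y (weierU a2 a4 a6) = 0 -> y * T = 1 ->
  ev2 g T (x * T) (weierV a2 a4 a6) = 0.
Proof.
rewrite ev2_weierU ev2_weierV => /eqP; rewrite subr_eq0 => /eqP yy yT.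
transitivity (y ^+ 2 * T ^+ 3 - T); first by rewrite yy; ring.
by rewrite [T ^+ 3]exprSr mulrA -exprMn yT expr1n mul1r subrr.
Qed.

End WeierstrassEval.

Section WeierstrassCurve.
Variables (R : comNzRingType) (a2 a4 a6 : R).
Variables (pU : proper_gen (weierU a2 a4 a6)).
Variables (pV : proper_gen (weierV a2 a4 a6)).

Definition weier_ringU : comNzRingType := pquot pU.
Definition weier_ringV : comNzRingType := pquot pV.

Definition weier_xU : weier_ringU := cls pU 'X%:P.
Definition weier_yU : weier_ringU := cls pU 'X.

Definition weier_strU : {rmorphism R -> weier_ringU} :=
  cls pU \o (polyC \o polyC).
Definition weier_strV : {rmorphism R -> weier_ringV} :=
  cls pV \o (polyC \o polyC).

Lemma ev2_clsU p : ev2 weier_strU weier_xU weier_yU p = cls pU p.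
Proof.
apply/esym/ev_uniq => // q.
exact: (ev_uniq (f := cls pU \o (polyC : {rmorphism {poly R} -> _}))).
Qed.

Variable pW : proper_gen (loc_rel weier_yU).

Definition weier_ringW : comNzRingType := loc pW.
Definition weier_resU : {rmorphism weier_ringU -> weier_ringW} := inloc pW.
Definition weier_strW : {rmorphism R -> weier_ringW} := weier_resU \o weier_strU.

Definition weier_x : weier_ringW := weier_resU weier_xU.
Definition weier_yinv : weier_ringW := locinv pW.

Lemma weierV_W : ev2 weier_strW weier_yinv (weier_x * weier_yinv)
                   (weierV a2 a4 a6) = 0.
Proof.
apply: (ev2_weierUV (y := weier_resU weier_yU)); last exact: mul_locinv.
by rewrite -ev2_comp ev2_clsU cls_gen rmorph0.
Qed.

Definition weier_resV : {rmorphism weier_ringV -> weier_ringW} :=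
  lift pV weierV_W.

Lemma weier_resU_str r : weier_resU (weier_strU r) = weier_strW r.
Proof. by []. Qed.

Lemma weier_resV_str r : weier_resV (weier_strV r) = weier_strW r.
Proof. by rewrite /weier_resV /weier_strV liftE /ev2 !evC. Qed.

(* The projective plane curve Y^2 Z = X^3 + a2 X^2 Z + a4 X Z^2 + a6 Z^3.     *)
Definition weier_curve : two_charts R :=
  TwoCharts weier_resU_str weier_resV_str.

(* dx/(2y) and x dx/(2y); h stands for 1/2. *)
Definition weier_omega (h : R) : form (chW weier_curve) :=
  [:: (weier_strW h * weier_yinv, weier_x)].
Definition weier_eta (h : R) : form (chW weier_curve) :=
  [:: (weier_x * weier_strW h * weier_yinv, weier_x)].

End WeierstrassCurve.

(* Rings below are shown to be nonzero by a Q-valued point; for the curve it  *)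
(* is (0, 1) on y^2 = x^3 + 1, that is b_2 = b_4 = 0, b_6 = 4.                *)
Definition int_rat : {rmorphism int -> rat} := intr.

Lemma int_rat_2 : int_rat 2 != 0.
Proof. by []. Qed.

Lemma proper_2 : proper_gen (loc_rel (2 : int)).
Proof. exact: loc_properP int_rat_2. Qed.

Definition Z12 : comNzRingType := loc proper_2.

Definition half12 : Z12 := locinv proper_2.

Lemma Z12_point : exists f : {rmorphism Z12 -> rat}, f half12 = 2^-1.
Proof.
by have [f _ fT] := loc_point proper_2 int_rat_2; exists f; rewrite fT.
Qed.

Definition o0 : 'I_3 := @Ordinal 3 0 isT.
Definition o1 : 'I_3 := @Ordinal 3 1 isT.
Definition o2 : 'I_3 := @Ordinal 3 2 isT.

Definition Z12b : comNzRingType := {mpoly Z12[3]}.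

(* h stands for 1/2. *)
Definition disc (R : comNzRingType) (h b2 b4 b6 : R) : R :=
  h ^+ 2 * (b2 ^+ 2 * (b4 ^+ 2 - b2 * b6))
  - 8 * b4 ^+ 3 - 27 * b6 ^+ 2 + 9 * b2 * b4 * b6.

Lemma rmorph_disc (R C : comNzRingType) (f : {rmorphism R -> C}) h b2 b4 b6 :
  f (disc h b2 b4 b6) = disc (f h) (f b2) (f b4) (f b6).
Proof. rewrite /disc; ring. Qed.

Lemma rmorph_sqM (R C : comNzRingType) (f : {rmorphism R -> C}) a b :
  f (a ^+ 2 * b) = f a ^+ 2 * f b.
Proof. by rewrite rmorphM rmorphXn. Qed.

Definition Delta : Z12b := disc half12%:MP 'X_o0 'X_o1 'X_o2.

Lemma Z12b_point : exists f : {rmorphism Z12b -> rat},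
  [/\ f half12%:MP = 2^-1, f 'X_o0 = 0, f 'X_o1 = 0 & f 'X_o2 = 4].
Proof.
have [f f2] := Z12_point.
exists (mmap f (fun i : 'I_3 => if i == o2 then 4 else 0)).
by split; rewrite /= ?mmapC // mmapX mmap1U.
Qed.

Lemma Delta_point : exists f : {rmorphism Z12b -> rat},
  [/\ f half12%:MP = 2^-1, f 'X_o0 = 0, f 'X_o1 = 0, f 'X_o2 = 4
    & f Delta != 0].
Proof.
have [f [f2 f0 f4 f6]] := Z12b_point; exists f; split=> //.
by rewrite /Delta rmorph_disc f2 f0 f4 f6.
Qed.

Lemma proper_Delta : proper_gen (loc_rel Delta).
Proof. by have [f [_ _ _ _ /loc_properP]] := Delta_point. Qed.

(* The schemes B_1, B_1 (x) Z[1/6] and Spec Z[1/6,e2,e4,e6,1/(e4^3-e6^2)] are  *)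
(* given by their coordinate rings B1, B1_6 and E1.                           *)
Definition B1 : comNzRingType := loc proper_Delta.

Definition B1_str : {rmorphism Z12 -> B1} :=
  inloc proper_Delta \o (@mpolyC 3 Z12 : {rmorphism Z12 -> Z12b}).

Definition half : B1 := inloc proper_Delta half12%:MP.
Definition b2 : B1 := inloc proper_Delta 'X_o0.
Definition b4 : B1 := inloc proper_Delta 'X_o1.
Definition b6 : B1 := inloc proper_Delta 'X_o2.

(* d/db_2, d/db_4, d/db_6 for i = o0, o1, o2. *)
Definition ddb (i : 'I_3) : B1 -> B1 := loc_der (ps := proper_Delta) (mderiv i).

Lemma B1_point : exists f : {rmorphism B1 -> rat},
  [/\ f half = 2^-1, f b2 = 0, f b4 = 0 & f b6 = 4].
Proof.
have [g [g2 g0 g4 g6 gD]] := Delta_point.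
have [f fE _] := loc_point proper_Delta gD.
by exists f; rewrite !fE.
Qed.

Definition a2 : B1 := half ^+ 2 * b2.
Definition a4 : B1 := half * b4.
Definition a6 : B1 := half ^+ 2 * b6.

Lemma X1_point : exists f : {rmorphism B1 -> rat},
  [/\ f a2 = 0, f a4 = 0 & f a6 = 1].
Proof.
have [f [f2 fb2 fb4 fb6]] := B1_point; exists f.
have sqM b : f (half ^+ 2 * b) = (f half) ^+ 2 * f b by exact: rmorph_sqM.
split; [rewrite sqM fb2 | rewrite [LHS]rmorphM fb4 | rewrite sqM fb6 f2] => //.
  by rewrite mulr0.
by rewrite mulr0.
Qed.

Lemma proper_U : proper_gen (weierU a2 a4 a6).
Proof.
have [f [f2 f4 f6]] := X1_point.
apply: (proper_gen_hom (f := ev2 f 0 1)).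
by rewrite ev2_weierU f2 f4 f6.
Qed.

Lemma proper_V : proper_gen (weierV a2 a4 a6).
Proof.
have [f [f2 f4 f6]] := X1_point.
apply: (proper_gen_hom (f := ev2 f 0 0)).
by rewrite ev2_weierV f2 f4 f6.
Qed.

Lemma proper_W : proper_gen (loc_rel (weier_yU proper_U)).
Proof.
have [f [f2 f4 f6]] := X1_point.
have f0 : ev2 f 0 1 (weierU a2 a4 a6) = 0 by rewrite ev2_weierU f2 f4 f6.
apply: (loc_properP (g := lift proper_U f0)).
by rewrite /weier_yU liftE /ev2 evX oner_eq0.
Qed.

Definition X1 : two_charts B1 := weier_curve proper_V proper_W.
Definition omega1 : form (chW X1) := weier_omega proper_V proper_W half.
Definition eta1 : form (chW X1) := weier_eta proper_V proper_W half.

Definition is_ramanujan (v : B1 -> B1) :=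
  vector_field B1_str v /\
  exists zw ze : cochain X1,
    [/\ second_kind_class omega1 zw, second_kind_class eta1 ze,
        gauss_manin v zw ze & gauss_manin v ze (cochain0 X1)].

Lemma proper_3 : proper_gen (loc_rel (3 : B1)).
Proof.
have [f _] := B1_point; apply: (loc_properP (g := f)).
by rewrite rmorph_nat.
Qed.

(* Z[1/6] = Z[1/2][1/3], so the base change of B1 to Z[1/6] is B1[1/3].       *)
Definition B1_6 : comNzRingType := loc proper_3.
Definition toB1_6 : {rmorphism B1 -> B1_6} := inloc proper_3.

Definition base_change_6 (v : B1 -> B1) : B1_6 -> B1_6 :=
  loc_der (ps := proper_3) v.

Lemma int_rat_6 : int_rat 6 != 0.
Proof. by []. Qed.

Lemma proper_6 : proper_gen (loc_rel (6 : int)).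
Proof. exact: loc_properP int_rat_6. Qed.

Definition Z16 : comNzRingType := loc proper_6.
Definition sixth16 : Z16 := locinv proper_6.

Definition Z16e : comNzRingType := {mpoly Z16[3]}.
Definition disc_e : Z16e := 'X_o1 ^+ 3 - 'X_o2 ^+ 2.

Lemma proper_e : proper_gen (loc_rel disc_e).
Proof.
have [f _ _] := loc_point proper_6 int_rat_6.
apply: (loc_properP (g := mmap f (fun i : 'I_3 => if i == o2 then 1 else 0))).
by rewrite /disc_e rmorphB !rmorphXn /= !mmapX !mmap1U.
Qed.

Definition E1 : comNzRingType := loc proper_e.

Definition sixth : E1 := inloc proper_e sixth16%:MP.
Definition e2 : E1 := inloc proper_e 'X_o0.
Definition e4 : E1 := inloc proper_e 'X_o1.
Definition e6 : E1 := inloc proper_e 'X_o2.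
Definition dde (i : 'I_3) : E1 -> E1 := loc_der (ps := proper_e) (mderiv i).

(* Main.v *)
From mathcomp Require Import all_boot all_order all_algebra.
From mathcomp Require Import generic_quotient mpoly boolp ring.
Require Import Defs.

Set Implicit Arguments.
Unset Strict Implicit.
Unset Printing Implicit Defensive.

Import GRing.Theory.
Local Open Scope ring_scope.

(* On each of the two charts and on their overlap, Omega^1 is free on         *)
(* omega = dx/(2y); let d be the dual vertical derivation.  Relative forms    *)
(* are then functions (a form s is < s, d > omega), and every identity        *)
(* between forms becomes a polynomial identity.                               *)
(*   Existence.  For y^2 = f(x) = x^3 + a2 x^2 + a4 x + a6 the field v11 reads *)
(* a2 |-> a4, a4 |-> 6 a6, a6 |-> 4 a2 a6 - a4^2.  It lifts to the affine     *)
(* chart by D x = 2 x^2 + 2 a2 x + a4, D y = (3 x + 2 a2) y, and then         *)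
(* L_D omega = eta and L_D eta = dy exactly.  At infinity the lift            *)
(* D - (x^2/y) d is regular; eta is the class of (eta, eta - d(x^2/y), x^2/y). *)
(*   Uniqueness.  If v also satisfies the two equations, correcting a lift of *)
(* v - v11 by a multiple of d gives a derivation E of the affine chart that   *)
(* commutes with d and has E x exact.  Splitting into even and odd parts in y *)
(* yields 2 A' f = A f' + (v - v11)(f) with A = 2 Q' f + Q f', and comparing  *)
(* leading coefficients forces Q = 0, hence (v - v11)(f) = 0.                 *)

(** * Derivations along a ring morphism *)

(** Everything is measured against the vertical field [d] with d x = 2 y and d y = f'(x), which
    pairs to 1 with omega. On each chart Omega^1 is free of rank one ([dual_basis_plane]), so a form
    is determined by its pairing with [d] ([form_eq_dual]). If a lift D of a base vector field
    satisfies [D, d] = m d, then L_D acts on these coefficients as D - m ([form_val_lie]).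
    Identities between derivations are tested on generators; comparing a derivation with its
    restriction to another chart produces derivations along a ring morphism.

    Existence ([ramanujan_cochains], [weier_gauss_manin]): on the affine chart v11 has a lift with
    [D, d] = - x d, whence L_D omega = x omega = eta and L_D eta = f'(x) omega = dy. The lift at
    infinity differs from it by (x^2/y) d, and x^2/y is also the function gluing the two halves of
    the class of eta, so the equations hold already for explicit cochains.

    Uniqueness ([gauss_manin_unique], [commuting_lift_eq0], [cubic_ode_eq0]): if v satisfies the
    same equations, then e = v - v11 has a lift E that commutes with [d] and sends x into the image
    of [d]. As the affine ring is free on 1, y over R[x], this becomes a differential equation for
    polynomials in x. The factors 2n - 3 and 2n + 3 of its leading terms are nonzero integers and
    [B1] is torsion free, so e kills a2, a4, a6, hence b2, b4, b6 because 2 is invertible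
    ([is_ramanujanP]).

    Over Z[1/6] the substitution for e2, e4, e6 is triangular with polynomial inverse, and e4^3 -
    e6^2 = 1728 Delta; this gives [eisenstein_iso]. The two fields then agree by the chain rule on
    e2, e4, e6 ([eisenstein_ramanujan]). *)

Definition der_along (S C : comNzRingType) (phi : S -> C) (M : lmodType C)
    (D : S -> M) :=
  (forall a b, D (a + b) = D a + D b) /\
  (forall a b, D (a * b) = phi a *: D b + phi b *: D a).

Section DerAlong.
Variables (S C : comNzRingType) (phi : {rmorphism S -> C}) (M : lmodType C).
Implicit Types D E : S -> M.

Lemma der_along0 D : der_along phi D -> D 0 = 0.
Proof.
by case=> DD _; have /eqP := DD 0 0; rewrite addr0 -subr_eq subrr => /eqP.
Qed.

Lemma der_alongN D : der_along phi D -> forall a, D (- a) = - D a.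
Proof.
move=> DP a; apply/eqP; rewrite -addr_eq0 -DP.1 addNr.
exact/eqP/der_along0.
Qed.

Lemma der_alongB D : der_along phi D -> forall a b, D (a - b) = D a - D b.
Proof. by move=> DP a b; rewrite DP.1 der_alongN. Qed.

Lemma der_along1 D : der_along phi D -> D 1 = 0.
Proof.
case=> _ DM; have /eqP := DM 1 1.
by rewrite !mul1r rmorph1 scale1r -subr_eq subrr => /eqP.
Qed.

Lemma der_along_nat D : der_along phi D -> forall n, D n%:R = 0.
Proof.
move=> DP; elim=> [|n IH]; first exact: der_along0 DP.
by rewrite -natr1 DP.1 IH (der_along1 DP) addr0.
Qed.

Lemma der_alongX D : der_along phi D ->
  forall a n, D (a ^+ n.+1) = (phi a ^+ n *: D a) *+ n.+1.
Proof.
move=> DP a; elim=> [|n IH]; first by rewrite !expr1 expr0 scale1r.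
rewrite exprS DP.2 IH -scalerMnr scalerA -exprS rmorphXn.
by rewrite [RHS]mulrSr.
Qed.

Lemma der_along_add D E :
  der_along phi D -> der_along phi E -> der_along phi (fun a => D a + E a).
Proof.
move=> DP EP; split=> a b; first by rewrite DP.1 EP.1 addrACA.
by rewrite DP.2 EP.2 addrACA -!scalerDr.
Qed.

Lemma der_along_sub D E :
  der_along phi D -> der_along phi E -> der_along phi (fun a => D a - E a).
Proof.
move=> DP EP; split=> a b; first by rewrite DP.1 EP.1 opprD addrACA.
by rewrite DP.2 EP.2 opprD addrACA !scalerBr.
Qed.

Lemma der_along_scale D (c : C) :
  der_along phi D -> der_along phi (fun a => c *: D a).
Proof.
move=> DP; split=> a b; first by rewrite DP.1 scalerDr.
by rewrite DP.2 scalerDr !scalerA ![c * _]mulrC.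
Qed.

Lemma der_along_mulr (d : S -> C) (m : M) :
  @der_along S C phi C^o d -> der_along phi (fun a => d a *: m).
Proof.
move=> dP; split=> a b; first by rewrite dP.1 scalerDl.
by rewrite dP.2 scalerDl -!scalerA.
Qed.

End DerAlong.

Lemma der_along_comp (S' S C : comNzRingType) (f : {rmorphism S' -> S})
    (phi : S -> C) (M : lmodType C) (D : S -> M) :
  der_along phi D -> der_along (phi \o f) (D \o f).
Proof.
by move=> DP; split=> a b /=; rewrite ?rmorphD ?rmorphM ?DP.1 ?DP.2.
Qed.

Lemma der_along_post (S C C' : comNzRingType) (phi : S -> C)
    (psi : {rmorphism C -> C'}) (D : S -> C) :
  @der_along S C phi C^o D -> @der_along S C' (psi \o phi) C'^o (psi \o D).
Proof.
move=> DP; split=> a b /=; first by rewrite DP.1 rmorphD.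
by rewrite DP.2 rmorphD !rmorphM.
Qed.

Lemma der_along_bracket (S : comNzRingType) (D E : S -> S) :
  @derivation S S^o D -> @derivation S S^o E ->
  @derivation S S^o (fun a => D (E a) - E (D a)).
Proof.
have scE (a b : S) : a *: (b : S^o) = a * b by [].
move=> DP EP; split=> a b; first by rewrite EP.1 !DP.1 EP.1 opprD addrACA.
rewrite EP.2 !DP.2 !scE DP.1 EP.1 !DP.2 !EP.2 !scE; ring.
Qed.

Section Vanishing.
Variable (C : comNzRingType) (M : lmodType C).

Lemma der_along_poly0 (A : comNzRingType) (phi : {rmorphism {poly A} -> C})
    (D : {poly A} -> M) :
  der_along phi D -> (forall a, D a%:P = 0) -> D 'X = 0 -> forall p, D p = 0.
Proof.
move=> DP DC DX; elim/poly_ind=> [|p a IH]; first exact: der_along0 DP.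
by rewrite DP.1 DP.2 IH DC DX !scaler0 !addr0.
Qed.

Lemma der_along_pquot0 (A : comNzRingType) (F : A) (pF : proper_gen F)
    (D : pquot pF -> M) :
  (forall a, D (cls pF a) = 0) -> forall z, D z = 0.
Proof. by move=> D0 z; rewrite -(cls_repr z). Qed.

(** Applying D to s * (1/s) = 1 gives s D(1/s) = 0, and s acts invertibly, so D also kills 1/s. *)
Lemma der_along_loc0 (A : comNzRingType) (s : A) (ps : proper_gen (loc_rel s))
    (phi : {rmorphism loc ps -> C}) (D : loc ps -> M) :
  der_along phi D -> (forall a, D (inloc ps a) = 0) -> forall z, D z = 0.
Proof.
move=> DP DA; apply: der_along_pquot0.
apply: (der_along_poly0 (phi := phi \o cls ps)) => //.
  exact: der_along_comp DP.
rewrite -/(locinv ps).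
have := congr1 D (mul_locinv ps); rewrite DP.2 DA scaler0 addr0.
rewrite (der_along1 DP) => /(congr1 (fun m => phi (locinv ps) *: m)).
by rewrite scaler0 scalerA -rmorphM mulrC mul_locinv rmorph1 scale1r.
Qed.

Lemma der_along_mpoly0 (A : comNzRingType) n
    (phi : {rmorphism {mpoly A[n]} -> C}) (D : {mpoly A[n]} -> M) :
  der_along phi D -> (forall a, D a%:MP = 0) -> (forall i, D 'X_i = 0) ->
  forall p, D p = 0.
Proof.
move=> DP DC DX; elim/mpolyind=> [|c m p _ _ IH]; first exact: der_along0 DP.
rewrite DP.1 IH addr0 -mul_mpolyC DP.2 DC scaler0 addr0 mpolyXE_id.
suff -> : D (\prod_(i < n) 'X_i ^+ m i) = 0 by rewrite scaler0.
elim/big_rec: _ => [|i q _ Dq]; first exact: der_along1 DP.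
rewrite DP.2 Dq scaler0 add0r; case: (m i) => [|k].
  by rewrite expr0 (der_along1 DP) scaler0.
by rewrite (der_alongX DP) DX scaler0 mul0rn scaler0.
Qed.

Lemma der_along_int0 (phi : {rmorphism int -> C}) (D : int -> M) :
  der_along phi D -> forall z, D z = 0.
Proof.
move=> DP [] n; first by have := der_along_nat DP n; rewrite natz.
rewrite NegzE (der_alongN DP).
by have := der_along_nat DP n.+1; rewrite natz => ->; rewrite oppr0.
Qed.

End Vanishing.

(** The extension of [d] to polynomials taking the value [c] at the variable: differentiate the
    coefficients, then add the chain rule term, all evaluated at [u]. *)
Definition poly_der (A C : comNzRingType) (g : {rmorphism A -> C}) (u : C)
    (d : A -> C) (c : C) (p : {poly A}) : C :=
  (map_poly d p).[u] + ev g u p^`() * c.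

Section PolyDer.
Variables (A C : comNzRingType) (g : {rmorphism A -> C}) (u : C).
Variables (d : A -> C) (c : C).
Hypothesis dP : @der_along A C g C^o d.

Let d0 : d 0 = 0. Proof. exact: der_along0 dP. Qed.

Let mapD p q : map_poly d (p + q) = map_poly d p + map_poly d q.
Proof. by apply/polyP => i; rewrite coefD !coef_map_id0 // coefD dP.1. Qed.

Let mapM p q : map_poly d (p * q) =
  map_poly g p * map_poly d q + map_poly g q * map_poly d p.
Proof.
apply/polyP => i; rewrite [X in _ + X]mulrC coefD !coef_map_id0 // !coefM.
rewrite (big_morph d dP.1 d0) -big_split; apply: eq_bigr => j _ /=.
by rewrite !coef_map_id0 ?rmorph0 // dP.2 [X in _ + X]mulrC.
Qed.

Lemma poly_der_der : @der_along {poly A} C (ev g u) C^o (poly_der g u d c).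
Proof.
rewrite /poly_der; split=> p q.
  by rewrite mapD hornerD derivD rmorphD mulrDl addrACA.
have scE (a b : C) : a *: (b : C^o) = a * b by [].
have evE f : ev g u f = (map_poly g f).[u] by [].
rewrite !scE mapM hornerD !hornerM derivM evD !evM !evE; ring.
Qed.

Lemma poly_derC a : poly_der g u d c a%:P = d a.
Proof.
rewrite /poly_der derivC rmorph0 mul0r addr0.
have -> : map_poly d a%:P = (d a)%:P.
  by apply/polyP => i; rewrite coef_map_id0 // !coefC; case: eqP.
by rewrite hornerC.
Qed.

Lemma poly_derX : poly_der g u d c 'X = c.
Proof.
rewrite /poly_der derivX rmorph1 mul1r.
suff -> : map_poly d 'X = 0 by rewrite horner0 add0r.
apply/polyP => i; rewrite coef_map_id0 // coefX coef0.
by case: eqP => // _; exact: der_along1 dP.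
Qed.

End PolyDer.

Section PquotDer.
Variables (S : comNzRingType) (F : S) (pF : proper_gen F) (D : S -> pquot pF).

(** Computed on a chosen representative; once D F = 0, the Leibniz rule makes the value independent
    of that choice. *)
Definition pquot_der (z : pquot pF) : pquot pF := D (repr z).

Hypotheses (DP : @der_along S (pquot pF) (cls pF) (pquot pF)^o D) (DF : D F = 0).

Lemma pquot_der_cls a : pquot_der (cls pF a) = D a.
Proof.
rewrite /pquot_der; have /cls_eq [q Eq] := cls_repr (cls pF a).
rewrite -[repr _](subrK a) Eq DP.1 DP.2 DF scaler0 cls_gen scale0r.
by rewrite addr0 add0r.
Qed.

Lemma pquot_der_der : @derivation (pquot pF) (pquot pF)^o pquot_der.
Proof.
split=> a b; rewrite -(cls_repr a) -(cls_repr b).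
  by rewrite -rmorphD !pquot_der_cls DP.1.
by rewrite -rmorphM !pquot_der_cls DP.2.
Qed.

End PquotDer.

(** * Denominators and torsion in localizations *)

Lemma inloc_eq0 (A : comNzRingType) (s : A) (ps : proper_gen (loc_rel s)) a :
  inloc ps a = 0 -> exists n, s ^+ n * a = 0.
Proof.
rewrite -(rmorph0 (cls ps)) => /cls_eq [q]; rewrite subr0 /loc_rel => Eq.
(* Comparing coefficients in a = q * (s T - 1) forces q to be the truncated geometric series - a (1
   + s T + ...), which must stop. *)
have q0 : q`_0 = - a.
  by have := congr1 (coefp 0) Eq; rewrite /= mulrBr mulr1 coefB mulrA coefMX
    coefC /= sub0r => ->; rewrite opprK.
have qS i : q`_i.+1 = s * q`_i.
  have := congr1 (coefp i.+1) Eq.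
  rewrite /= mulrBr mulr1 coefB mulrA coefMX coefC /= coefMC => /esym/eqP.
  by rewrite subr_eq0 mulrC => /eqP.
have qn i : q`_i = - (s ^+ i * a).
  by elim: i => [|i IH]; rewrite ?expr0 ?mul1r // qS IH exprS mulrN mulrA.
exists (size q); apply/eqP; rewrite -oppr_eq0 -qn.
by rewrite nth_default.
Qed.

Lemma loc_den (A : comNzRingType) (s : A) (ps : proper_gen (loc_rel s))
    (z : loc ps) : exists n a, inloc ps s ^+ n * z = inloc ps a.
Proof.
rewrite -(cls_repr z); elim/poly_ind: (repr z) => [|p c [n [a Ea]]].
  by exists 0%N, 0; rewrite !rmorph0 mulr0.
exists n.+1, (a + s ^+ n.+1 * c).
rewrite [cls ps _]rmorphD [cls ps (_ * _)]rmorphM mulrDr exprSr.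
have -> : inloc ps s ^+ n * inloc ps s * (cls ps p * cls ps 'X) =
  inloc ps s ^+ n * cls ps p * (inloc ps s * locinv ps).
  by rewrite /locinv /=; ring.
by rewrite Ea mul_locinv mulr1 -exprSr [RHS]rmorphD [X in _ = _ + X]rmorphM rmorphXn.
Qed.

Lemma loc_eq0 (A : comNzRingType) (s : A) (ps : proper_gen (loc_rel s))
    (z : loc ps) n : inloc ps s ^+ n * z = 0 -> z = 0.
Proof.
move=> z0; have : locinv ps ^+ n * (inloc ps s ^+ n * z) = 0 by rewrite z0 mulr0.
by rewrite mulrA -exprMn mulrC [locinv ps * _]mulrC mul_locinv expr1n mulr1.
Qed.

Definition torsion_free (A : comNzRingType) :=
  forall (a : A) n, a *+ n.+1 = 0 -> a = 0.

Lemma torsion_free_loc (A : comNzRingType) (s : A)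
    (ps : proper_gen (loc_rel s)) : torsion_free A -> torsion_free (loc ps).
Proof.
move=> tfA z n zn0; have [m [a Ea]] := loc_den z.
have /inloc_eq0 [k] : inloc ps (a *+ n.+1) = 0.
  by rewrite rmorphMn -Ea -mulrnAr zn0 mulr0.
rewrite mulrnAr => /tfA ka0; apply: (loc_eq0 (n := k + m)).
by rewrite exprD -mulrA Ea -rmorphXn -rmorphM ka0 rmorph0.
Qed.

Lemma torsion_free_mpoly (A : comNzRingType) n :
  torsion_free A -> torsion_free {mpoly A[n]}.
Proof.
move=> tfA p m pm0; apply/mpolyP => k; rewrite mcoeff0; apply: (tfA _ m).
by rewrite -mcoeffMn pm0 mcoeff0.
Qed.

(** * Relative forms and plane charts *)

Section RelativeForms.
Variables (R A : comNzRingType) (str : {rmorphism R -> A}).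

Lemma form_val_cat (M : lmodType A) (dl : A -> M) s s' :
  form_val dl (s ++ s') = form_val dl s + form_val dl s'.
Proof. exact: big_cat. Qed.

Lemma form_val_d (M : lmodType A) (dl : A -> M) g :
  form_val dl (form_d g) = dl g.
Proof. by rewrite /form_val big_seq1 scale1r. Qed.

Definition form_scale (c : A) (s : form A) : form A :=
  [seq (c * p.1, p.2) | p <- s].

Lemma form_val_scale (M : lmodType A) (dl : A -> M) c s :
  form_val dl (form_scale c s) = c *: form_val dl s.
Proof.
rewrite /form_val big_map scaler_sumr.
by apply: eq_bigr => p _; rewrite scalerA.
Qed.

(* Omega^1_{A/R} is free with basis w, and d is the dual basis of Der_R(A, A) *)
Definition dual_basis (d : A -> A) (w : form A) :=
  [/\ vector_field str d, @form_val A A^o d w = 1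
    & forall (M : lmodType A) (dl : A -> M), rel_derivation str dl ->
        forall a, dl a = d a *: form_val dl w].

Section DualBasis.
Variables (d : A -> A) (w : form A).
Hypothesis dw : dual_basis d w.

(** Every R-derivation is a multiple of [d], so its value on a form is the [d]-value of the form
    times its value on the basis [w]. *)
Lemma form_eq_dual s s' :
  form_eq str s s' <-> @form_val A A^o d s = @form_val A A^o d s'.
Proof.
have [dR _ dU] := dw; split=> [/(_ A^o d dR) // | E M dl dlR].
suff val_dual r : form_val dl r = @form_val A A^o d r *: form_val dl w.
  by rewrite [LHS]val_dual [RHS]val_dual E.
rewrite {2}/form_val scaler_suml; apply: eq_bigr => p _.
by rewrite (dU _ _ dlR p.2) !scalerA.
Qed.

End DualBasis.

(** The Leibniz rule <L_D s, d> = D <s, d> - <s, [D, d]>, with [D, d] = m d. *)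
Lemma form_val_lie (d D : A -> A) (m : A) (s : form A) :
  @derivation A A^o D -> (forall a, D (d a) - d (D a) = m * d a) ->
  @form_val A A^o d (lie D s) =
  D (@form_val A A^o d s) - m * @form_val A A^o d s.
Proof.
move=> DP Dd; rewrite /form_val big_cat !big_map /= -big_split /=.
have D0 : D 0 = 0.
  by have /eqP := DP.1 0 0; rewrite addr0 -subr_eq subrr => /eqP.
rewrite (big_morph D DP.1 D0) [m * _]mulr_sumr -sumrB; apply: eq_bigr => p _.
have scE (a b : A) : a *: (b : A^o) = a * b by [].
rewrite !scE DP.2 !scE.
have -> : d (D p.2) = D (d p.2) - m * d p.2 by rewrite -Dd subKr.
by ring.
Qed.

Lemma form_val_map (A' : comNzRingType) (f : {rmorphism A -> A'}) (d : A -> A)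
    (d' : A' -> A') s :
  (forall a, d' (f a) = f (d a)) ->
  @form_val A' A'^o d' (form_map f s) = f (@form_val A A^o d s).
Proof.
move=> df; rewrite /form_val big_map raddf_sum; apply: eq_bigr => p _ /=.
by rewrite df [RHS]rmorphM.
Qed.

End RelativeForms.

Section RingDerivation.
Variables (A : comNzRingType) (D : A -> A).
Hypothesis DP : @derivation A A^o D.

Lemma der_add a b : D (a + b) = D a + D b. Proof. exact: DP.1. Qed.
Lemma der_mul a b : D (a * b) = a * D b + b * D a. Proof. exact: DP.2. Qed.
Lemma der_zero : D 0 = 0.
Proof. exact: (@der_along0 A A idfun A^o _ DP). Qed.
Lemma der_one : D 1 = 0.
Proof. exact: (@der_along1 A A idfun A^o _ DP). Qed.
Lemma der_opp a : D (- a) = - D a.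
Proof. exact: (@der_alongN A A idfun A^o _ DP). Qed.
Lemma der_exp a n : D (a ^+ n.+1) = (n.+1)%:R * a ^+ n * D a.
Proof. by rewrite (@der_alongX A A idfun A^o _ DP) -mulrA mulr_natl. Qed.
Lemma der_nat n : D n%:R = 0.
Proof. exact: (@der_along_nat A A idfun A^o _ DP). Qed.

Definition derE := (der_add, der_mul, der_exp, der_opp, der_one, der_zero, der_nat).

End RingDerivation.

Section PlaneChart.
Variables (R : comNzRingType) (F : {poly {poly R}}) (pF : proper_gen F).

Definition chart : comNzRingType := pquot pF.
Definition chart_str : {rmorphism R -> chart} := cls pF \o (polyC \o polyC).
Definition chart_u : chart := cls pF 'X%:P.
Definition chart_v : chart := cls pF 'X.

Lemma ev2_chart p : ev2 chart_str chart_u chart_v p = cls pF p.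
Proof.
apply/esym/ev_uniq => // q.
exact: (ev_uniq (f := cls pF \o (polyC : {rmorphism {poly R} -> _}))).
Qed.

Lemma der_along_chart0 (C : comNzRingType) (M : lmodType C)
    (phi : {rmorphism chart -> C}) (D : chart -> M) :
  der_along phi D -> (forall r, D (chart_str r) = 0) ->
  D chart_u = 0 -> D chart_v = 0 -> forall z, D z = 0.
Proof.
move=> DP Dr Du Dv; apply: der_along_pquot0.
have DcP := der_along_comp (cls pF) DP.
apply: (der_along_poly0 DcP) => // p /=; move: p.
by apply: (der_along_poly0 (der_along_comp (polyC) DcP)).
Qed.

(** Derivation over [e] with prescribed values at the two coordinates. With [e] zero and values (1,
    0) or (0, 1) it is a partial derivative read on the chart. *)
Definition pre_chart_der (e : R -> R) (cu cv : chart) : {poly {poly R}} -> chart :=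
  poly_der (ev chart_str chart_u) chart_v
    (poly_der chart_str chart_u (chart_str \o e) cu) cv.

Definition chart_der (e : R -> R) (cu cv : chart) : chart -> chart :=
  pquot_der (pre_chart_der e cu cv).

Section Der.
Variables (e : R -> R) (cu cv : chart).
Hypothesis eP : @derivation R R^o e.
Let D := pre_chart_der e cu cv.

Let str_e : @der_along R chart chart_str chart^o (chart_str \o e).
Proof. exact: (der_along_post chart_str (phi := id) eP). Qed.

Lemma pre_chart_der_der : @der_along {poly {poly R}} chart (cls pF) chart^o D.
Proof.
have DP := poly_der_der chart_v cv (poly_der_der chart_u cu str_e).
split=> a b; first exact: DP.1.
by rewrite -!ev2_chart; exact: DP.2.
Qed.

Lemma pre_chart_derC r : D r%:P%:P = chart_str (e r).
Proof.
by rewrite /D/pre_chart_der poly_derC ?poly_derC //; exact: poly_der_der.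
Qed.

Lemma pre_chart_der_u : D 'X%:P = cu.
Proof.
by rewrite /D/pre_chart_der poly_derC ?poly_derX //; exact: poly_der_der.
Qed.

Lemma pre_chart_der_v : D 'X = cv.
Proof. by rewrite /D/pre_chart_der poly_derX //; exact: poly_der_der. Qed.

Hypothesis DF : D F = 0.

Lemma chart_derP : @derivation chart chart^o (chart_der e cu cv).
Proof. exact: pquot_der_der pre_chart_der_der DF. Qed.

Lemma chart_der_str r : chart_der e cu cv (chart_str r) = chart_str (e r).
Proof. by rewrite -pre_chart_derC; apply: (pquot_der_cls pre_chart_der_der). Qed.

Lemma chart_der_u : chart_der e cu cv chart_u = cu.
Proof. by rewrite -[RHS]pre_chart_der_u; apply: (pquot_der_cls pre_chart_der_der). Qed.

Lemma chart_der_v : chart_der e cu cv chart_v = cv.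
Proof. by rewrite -[RHS]pre_chart_der_v; apply: (pquot_der_cls pre_chart_der_der). Qed.

End Der.

Lemma derivation0 : @derivation R R^o (fun=> 0).
Proof. by split=> a b; rewrite ?addr0 ?scaler0 ?addr0. Qed.

(* The relation F_u du + F_v dv = 0. *)
Lemma chart_rel (M : lmodType chart) (dl : chart -> M) :
  rel_derivation chart_str dl ->
  pre_chart_der (fun=> 0) 1 0 F *: dl chart_u
  + pre_chart_der (fun=> 0) 0 1 F *: dl chart_v = 0.
Proof.
move=> [dlP dl0].
(* E measures the failure of the chain rule; it vanishes on constants and on both coordinates, hence
   on F, whose class is 0. *)
pose E p := (pre_chart_der (fun=> 0) 1 0 p *: dl chart_u
  + pre_chart_der (fun=> 0) 0 1 p *: dl chart_v) - dl (cls pF p).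
have EP : der_along (cls pF) E.
  apply: der_along_sub; last exact: (der_along_comp (cls pF) dlP).
  have [uP vP] := (pre_chart_der_der 1 0 derivation0, pre_chart_der_der 0 1 derivation0).
  exact: der_along_add (der_along_mulr (dl chart_u) uP)
                       (der_along_mulr (dl chart_v) vP).
have E0 : forall p, E p = 0.
  apply: (der_along_poly0 EP); last first.
    rewrite /E !pre_chart_der_v; try exact: derivation0.
    by rewrite scale0r scale1r add0r subrr.
  apply: (der_along_poly0 (der_along_comp (polyC) EP)) => [r|] /=.
    rewrite /E !pre_chart_derC; try exact: derivation0.
    by rewrite rmorph0 !scale0r addr0 sub0r [X in - X]dl0 oppr0.
  rewrite /E !pre_chart_der_u; try exact: derivation0.
  by rewrite scale0r scale1r addr0 subrr.
have := E0 F; rewrite /E cls_gen => /eqP; rewrite subr_eq0 => /eqP ->.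
exact: (@der_along0 chart chart idfun M _ dlP).
Qed.

Lemma chart_intertwine (C : comNzRingType) (f : {rmorphism chart -> C})
    (D : chart -> chart) (D' : C -> C) :
  @derivation chart chart^o D -> @derivation C C^o D' ->
  (forall r, D' (f (chart_str r)) = f (D (chart_str r))) ->
  D' (f chart_u) = f (D chart_u) -> D' (f chart_v) = f (D chart_v) ->
  forall z, D' (f z) = f (D z).
Proof.
move=> DP DP' Dr Du Dv z.
have E := der_along_sub (phi := f) (der_along_comp f DP')
  (der_along_post f (phi := idfun) DP).
apply/eqP; rewrite -subr_eq0; apply/eqP; move: z.
apply: (der_along_chart0 E) => [r||] /=.
- by rewrite -[X in X = 0]/(D' (f (chart_str r)) - f (D (chart_str r))) Dr subrr.
- by rewrite Du subrr.
- by rewrite Dv subrr.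
Qed.

(** Here [d] is k times the Hamiltonian field (F_v, - F_u), tangent to F = 0. Modulo the relation
    F_u du + F_v dv = 0, the Bezout identity lets P du + Q dv recover both du and dv. *)
Lemma dual_basis_plane (Fu Fv k P Q : chart) (d : chart -> chart) :
  pre_chart_der (fun=> 0) 1 0 F = Fu -> pre_chart_der (fun=> 0) 0 1 F = Fv ->
  vector_field chart_str d -> d chart_u = k * Fv -> d chart_v = - (k * Fu) ->
  k * (P * Fv - Q * Fu) = 1 ->
  dual_basis chart_str d [:: (P, chart_u); (Q, chart_v)].
Proof.
move=> EFu EFv dR du dv PQ.
have val2 (M : lmodType chart) (dl : chart -> M) :
    form_val dl [:: (P, chart_u); (Q, chart_v)] =
    P *: dl chart_u + Q *: dl chart_v by rewrite /form_val big_cons big_seq1.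
split=> // [|M dl dlR a].
  by rewrite val2 du dv -[RHS]PQ; rewrite -[_ *: _]/(_ * _) -[Q *: _]/(_ * _); ring.
apply/eqP; rewrite -subr_eq0; apply/eqP; rewrite val2.
have := chart_rel dlR; rewrite EFu EFv.
set m := dl chart_u; set n := dl chart_v => rel.
have Fum : Fu *: m = - (Fv *: n) by apply/eqP; rewrite -addr_eq0 rel.
have Fvn : Fv *: n = - (Fu *: m) by rewrite Fum opprK.
move: a; apply: (der_along_chart0 (phi := idfun)) => [|r||].
- apply: der_along_sub; first exact: dlR.1.
  exact: (der_along_mulr (phi := idfun) (P *: m + Q *: n) dR.1).
- by rewrite dlR.2 dR.2 scale0r subrr.
- rewrite du scalerDr !scalerA -[k * Fv * Q]mulrAC -[(k * Q * Fv) *: n]scalerA.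
  rewrite Fvn scalerN scalerA -scalerBl -[X in X *: m](_ : 1 = _) ?scale1r ?subrr //.
  by rewrite -[LHS]PQ; ring.
- rewrite dv scaleNr opprK scalerDr !scalerA -[k * Fu * P]mulrAC.
  rewrite -[(k * P * Fu) *: m]scalerA Fum scalerN scalerA [- _ + _]addrC.
  rewrite -scalerBl -[X in n + X *: n](_ : -1 = _) ?scaleN1r ?subrr //.
  by rewrite -PQ; ring.
Qed.

End PlaneChart.

(** * The affine chart *)

Section DerWeier.
Variables (R C : comNzRingType) (phi : {rmorphism {poly {poly R}} -> C}).
Variable D : {poly {poly R}} -> C.
Hypothesis DP : @der_along _ C phi C^o D.

Let DD a b : D (a + b) = D a + D b. Proof. exact: DP.1. Qed.
Let DB a b : D (a - b) = D a - D b. Proof. exact: (der_alongB DP). Qed.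
Let DM a b : D (a * b) = phi a * D b + phi b * D a. Proof. exact: DP.2. Qed.
Let DX a n : D (a ^+ n.+1) = n.+1%:R * phi a ^+ n * D a.
Proof. by rewrite (der_alongX DP) -mulrA mulr_natl. Qed.

Let EP := der_along_comp polyC DP.
Let ED a b : D (a + b)%:P = D a%:P + D b%:P. Proof. exact: EP.1. Qed.
Let EB a b : D (a - b)%:P = D a%:P - D b%:P.
Proof. exact: (der_alongB (phi := phi \o polyC) EP). Qed.
Let EM a b : D (a * b)%:P = phi a%:P * D b%:P + phi b%:P * D a%:P.
Proof. exact: EP.2. Qed.
Let EX a n : D (a ^+ n.+1)%:P = n.+1%:R * phi a%:P ^+ n * D a%:P.
Proof.
by rewrite [LHS](der_alongX (phi := phi \o polyC) EP) -mulrA mulr_natl.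
Qed.
Let phM a b : phi (a * b)%:P = phi a%:P * phi b%:P.
Proof. by rewrite polyCM rmorphM. Qed.
Let phX a n : phi (a ^+ n)%:P = phi a%:P ^+ n.
Proof. by rewrite polyC_exp rmorphXn. Qed.

Lemma der_along_weierU a2 a4 a6 :
  let u := phi 'X%:P in
  D (weierU a2 a4 a6) = 2 * phi 'X * D 'X
    - (3 * u ^+ 2 + 2 * phi a2%:P%:P * u + phi a4%:P%:P) * D 'X%:P
    - (D a2%:P%:P * u ^+ 2 + D a4%:P%:P * u + D a6%:P%:P).
Proof.
rewrite /weierU /= DB DX !ED !(EM a2%:P, EM a4%:P) !EX phX expr1; ring.
Qed.

Lemma der_along_weierV a2 a4 a6 :
  let w := phi 'X%:P in let t := phi 'X in
  let c2 := phi a2%:P%:P in let c4 := phi a4%:P%:P in let c6 := phi a6%:P%:P in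
  D (weierV a2 a4 a6) =
    (3 * t ^+ 2 + 2 * c2 * w * t + c4 * w ^+ 2) * D 'X
    + (c2 * t ^+ 2 + 2 * c4 * w * t + 3 * c6 * w ^+ 2 - 1) * D 'X%:P
    + (D a2%:P%:P * w * t ^+ 2 + D a4%:P%:P * w ^+ 2 * t + D a6%:P%:P * w ^+ 3).
Proof.
rewrite /weierV /= !DD EB DX !(DM (a2%:P * 'X)%:P, DM (a4%:P * 'X^2)%:P).
rewrite DX !(EM a2%:P, EM a4%:P, EM a6%:P) !EX.
rewrite !(phM a2%:P, phM a4%:P, phM a6%:P) !phX !rmorphXn; ring.
Qed.

End DerWeier.

(** Identities modulo a curve equation e = 0 are certified by an explicit cofactor q, which leaves a
    plain polynomial identity for [ring]. *)
Lemma eq_mod (C : comNzRingType) (e q a b : C) : e = 0 -> a - b = q * e -> a = b.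
Proof. by move=> -> /eqP; rewrite mulr0 subr_eq0 => /eqP. Qed.

(** * Polynomial identities for the cubic and for the chart at infinity *)

Section Formulas.
Variables (C : comNzRingType) (c2 c4 c6 : C).

Definition cubic x := x ^+ 3 + c2 * x ^+ 2 + c4 * x + c6.
Definition dcubic x := 3 * x ^+ 2 + 2 * c2 * x + c4.

(* The prefix v marks functions on the chart at infinity, with coordinates    *)
(* w = 1/y and t = x/y.                                                       *)
Definition vF w t :=
  t ^+ 3 + c2 * w * t ^+ 2 + c4 * w ^+ 2 * t + (c6 * w ^+ 3 - w).
Definition vFt w t := 3 * t ^+ 2 + 2 * c2 * w * t + c4 * w ^+ 2.
Definition vFw w t := c2 * t ^+ 2 + 2 * c4 * w * t + 3 * c6 * w ^+ 2 - 1.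

(* On vF = 0 one has t^3 = w vs. *)
Definition vs w t := 1 - c2 * t ^+ 2 - c4 * w * t - c6 * w ^+ 2.

(* Modulo vF, 2 w = t vFt + w vFw and (1 + c2 t^2) vFw = - 1 + w vm, so vFt   *)
(* and vFw generate the unit ideal.                                           *)
Definition vm w t :=
  c2 ^+ 2 * t * vs w t + (2 * c4 * t + 3 * c6 * w) * (1 + c2 * t ^+ 2).

(* The regular vector field D - (x^2/y) d at infinity. *)
Definition vDt w t :=
  c4 * w - c2 * t + c2 ^+ 2 * t ^+ 3 + c2 * c4 * w * t ^+ 2
  + c2 * c6 * t * w ^+ 2 - 2 * c4 * t ^+ 3 - 3 * c6 * t ^+ 2 * w.
Definition vDw w t :=
  - 2 * c2 * w - c2 * t ^+ 3 - 2 * c4 * w * t ^+ 2 - 3 * c6 * t * w ^+ 2.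

(* The regular function (eta - d(x^2/y)) / omega at infinity. *)
Definition vb w t := - c2 * vs w t - 2 * c4 * t ^+ 2 - 3 * c6 * w * t.

(* At infinity L_D (eta - d(x^2/y)) is exact, equal to d vh. *)
Definition vh w t :=
  - c2 * (c2 * t * vs w t + c4 * t ^+ 3 + c6 * w * t ^+ 2)
  + c4 * t * (2 * vs w t - 1) + c6 * w * (1 + 3 * vs w t).

(** [bezA] and [bezB] are Bezout cofactors of the cubic and its derivative, whose combination is the
    discriminant [cubic_disc]. *)
Definition bezA x :=
  (18 * c4 - 6 * c2 ^+ 2) * x + (15 * c2 * c4 - 4 * c2 ^+ 3 - 27 * c6).
Definition bezB x :=
  (2 * c2 ^+ 2 - 6 * c4) * x ^+ 2 + (2 * c2 ^+ 3 - 7 * c2 * c4 + 9 * c6) * x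
  + (c2 ^+ 2 * c4 + 3 * c2 * c6 - 4 * c4 ^+ 2).
Definition cubic_disc :=
  c2 ^+ 2 * c4 ^+ 2 - 4 * c4 ^+ 3 - 4 * c2 ^+ 3 * c6 - 27 * c6 ^+ 2
  + 18 * c2 * c4 * c6.

Lemma cubic_bezout x :
  bezA x * cubic x + bezB x * dcubic x = cubic_disc.
Proof. rewrite /bezA /bezB /cubic /dcubic /cubic_disc; ring. Qed.

(** By the two congruences stated at [vm], the left side is h vm (2 w) + (1 - w vm) = 1. *)
Lemma vF_smooth h w t : 2 * h = 1 -> vF w t = 0 ->
  (h * vm w t * w - (1 + c2 * t ^+ 2)) * vFw w t + h * vm w t * t * vFt w t = 1.
Proof.
move=> h2 F0.
transitivity (h * (vm w t * (w * vFw w t + t * vFt w t)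
                   - 2 * (1 + c2 * t ^+ 2) * vFw w t)
   + (2 * h - 1) * ((1 + c2 * t ^+ 2) * vFw w t)); first by ring.
rewrite h2 subrr mul0r addr0 -[RHS]h2 [2 * h]mulrC; congr (h * _).
apply: (eq_mod (q := - 3 * t ^+ 3 * c2 ^+ 3 + 6 * t ^+ 3 * c2 * c4
  - 3 * t ^+ 2 * w * c2 ^+ 2 * c4 + 9 * t ^+ 2 * w * c2 * c6
  - 3 * t * w ^+ 2 * c2 ^+ 2 * c6 + t * c2 ^+ 2 + 6 * t * c4 + 9 * w * c6) F0).
rewrite /vm /vs /vFw /vFt /vF; ring.
Qed.

End Formulas.

Section ChartU.
Variables (R : comNzRingType) (a2 a4 a6 h di : R).
Hypotheses (h2 : 2 * h = 1) (disc1 : cubic_disc a2 a4 a6 * di = 1).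
Variable pU : proper_gen (weierU a2 a4 a6).

Let U := chart pU.
Let str : {rmorphism R -> U} := chart_str pU.
Let x : U := chart_u pU.
Let y : U := chart_v pU.
Let f' := dcubic (str a2) (str a4).

Lemma weierU_eq : y ^+ 2 = cubic (str a2) (str a4) (str a6) x.
Proof.
by apply/eqP; rewrite -subr_eq0 -ev2_weierU ev2_chart cls_gen.
Qed.

(** Tangency condition: the derivation descends to the chart when it respects y^2 = f(x), the
    coefficients of f moving along [e]. *)
Lemma chart_derU_eq0 (e : R -> R) (cu cv : U) : @derivation R R^o e ->
  2 * y * cv = f' x * cu
    + (str (e a2) * x ^+ 2 + str (e a4) * x + str (e a6)) ->
  pre_chart_der e cu cv (weierU a2 a4 a6) = 0 :> U.
Proof.
move=> eP Ecv; rewrite (der_along_weierU (pre_chart_der_der cu cv eP)).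
rewrite !pre_chart_derC // pre_chart_der_u // pre_chart_der_v //.
by rewrite [2 * _ * cv]Ecv /f' /dcubic -/x -/(str a2) -/(str a4); ring.
Qed.

Definition dU : U -> U := chart_der (fun=> 0) (2 * y) (f' x).

Let dU_eq0 : pre_chart_der (fun=> 0) (2 * y) (f' x) (weierU a2 a4 a6) = 0 :> U.
Proof.
by apply: chart_derU_eq0 => [|]; [exact: derivation0 | rewrite rmorph0; ring].
Qed.

Lemma dU_vf : vector_field str dU.
Proof.
split=> [|r]; first exact: (chart_derP (derivation0 R) dU_eq0).
by rewrite [LHS](chart_der_str (derivation0 R) dU_eq0) rmorph0.
Qed.

Lemma dU_x : dU x = 2 * y. Proof. exact: chart_der_u (derivation0 R) dU_eq0. Qed.
Lemma dU_y : dU y = f' x. Proof. exact: chart_der_v (derivation0 R) dU_eq0. Qed.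

(* dx/(2y) on the chart U, from the Bezout relation for y^2 and f'(x). *)
Definition omegaU : form U :=
  [:: (str (di * h) * bezA (str a2) (str a4) (str a6) x * y, x);
      (str di * bezB (str a2) (str a4) (str a6) x, y)].

Let omegaU_coef : str (di * h) * bezA (str a2) (str a4) (str a6) x * y * (2 * y)
  + str di * bezB (str a2) (str a4) (str a6) x * f' x = 1.
Proof.
transitivity (str di * (str (2 * h) * bezA (str a2) (str a4) (str a6) x * y ^+ 2
   + bezB (str a2) (str a4) (str a6) x * f' x)); first by ring.
rewrite h2 rmorph1 mul1r weierU_eq cubic_bezout -(rmorph1 str) -disc1.
by rewrite /cubic_disc; ring.
Qed.

Section RamanujanU.
Variable v : R -> R.
Hypotheses (vP : @derivation R R^o v) (va2 : v a2 = a4) (va4 : v a4 = 6 * a6).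
Hypothesis va6 : v a6 = 4 * a2 * a6 - a4 ^+ 2.

Definition DU : U -> U :=
  chart_der v (2 * x ^+ 2 + 2 * str a2 * x + str a4) ((3 * x + 2 * str a2) * y).

Let DU_eq0 : pre_chart_der v (2 * x ^+ 2 + 2 * str a2 * x + str a4)
  ((3 * x + 2 * str a2) * y) (weierU a2 a4 a6) = 0 :> U.
Proof.
apply: chart_derU_eq0 => //; rewrite va2 va4 va6 /f' /dcubic.
transitivity (2 * (3 * x + 2 * str a2) * y ^+ 2); first by ring.
by rewrite weierU_eq /cubic -/x; ring.
Qed.

Lemma DU_der : @derivation U U^o DU. Proof. exact: chart_derP vP DU_eq0. Qed.
Lemma DU_str r : DU (str r) = str (v r).
Proof. exact: chart_der_str vP DU_eq0 r. Qed.
Lemma DU_x : DU x = 2 * x ^+ 2 + 2 * str a2 * x + str a4.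
Proof. exact: chart_der_u vP DU_eq0. Qed.
Lemma DU_y : DU y = (3 * x + 2 * str a2) * y.
Proof. exact: chart_der_v vP DU_eq0. Qed.

(** This bracket is what turns L_D omega into x omega = eta. *)
Lemma DU_dU z : DU (dU z) - dU (DU z) = - x * dU z.
Proof.
have [dP d0] := dU_vf; have DP := DU_der.
have E := (der_along_sub (phi := idfun) (der_along_bracket DP dP)
  (der_along_scale (phi := idfun) (- x) dP)).
apply/eqP; rewrite -subr_eq0; apply/eqP; move: z.
apply: (der_along_chart0 E) => [r||].
- by rewrite DU_str !d0 (der_zero DP) scaler0 !subr0.
- rewrite -/x -[_ *: _]/(_ * _) DU_x dU_x !(derE DP, derE dP) DU_y dU_x !d0.
  by ring.
- rewrite -/y -[_ *: _]/(_ * _) DU_y dU_y /f' /dcubic.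
  rewrite !(derE DP, derE dP) dU_y dU_x DU_x !DU_str !d0 va2 va4 /f' /dcubic.
  have y0 : y ^+ 2 - cubic (str a2) (str a4) (str a6) x = 0.
    by rewrite weierU_eq subrr.
  by apply: (eq_mod (q := - 6) y0); rewrite /cubic; ring.
Qed.

End RamanujanU.

Lemma dual_basisU : dual_basis str dU omegaU.
Proof.
have D0 := derivation0 R.
apply: (@dual_basis_plane _ _ pU (- f' x) (2 * y) 1); last first.
- by rewrite -[RHS]omegaU_coef; ring.
- by rewrite -/y dU_y; ring.
- by rewrite -/x dU_x mul1r.
- exact: dU_vf.
- rewrite (der_along_weierU (pre_chart_der_der _ _ D0)) !pre_chart_derC //.
  by rewrite pre_chart_der_u // pre_chart_der_v // rmorph0 -/y; ring.
- rewrite (der_along_weierU (pre_chart_der_der _ _ D0)) !pre_chart_derC //.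
  by rewrite pre_chart_der_u // pre_chart_der_v // rmorph0 /f' /dcubic -/x; ring.
Qed.

End ChartU.

(** * The chart at infinity *)

Section ChartV.
Variables (R : comNzRingType) (a2 a4 a6 h : R).
Hypothesis h2 : 2 * h = 1.
Variable pV : proper_gen (weierV a2 a4 a6).

Let V := chart pV.
Let str : {rmorphism R -> V} := chart_str pV.
Let w : V := chart_u pV.
Let t : V := chart_v pV.
Let Ft := vFt (str a2) (str a4).
Let Fw := vFw (str a2) (str a4) (str a6).

Lemma weierV_eq : vF (str a2) (str a4) (str a6) w t = 0.
Proof. by rewrite /vF -ev2_weierV ev2_chart cls_gen. Qed.

Lemma chart_derV_eq0 (e : R -> R) (cw ct : V) : @derivation R R^o e ->
  Ft w t * ct + Fw w t * cw + (str (e a2) * w * t ^+ 2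
    + str (e a4) * w ^+ 2 * t + str (e a6) * w ^+ 3) = 0 ->
  pre_chart_der e cw ct (weierV a2 a4 a6) = 0 :> V.
Proof.
move=> eP Ec; rewrite (der_along_weierV (pre_chart_der_der cw ct eP)).
by rewrite !pre_chart_derC // pre_chart_der_u // pre_chart_der_v.
Qed.

(** The Hamiltonian field of the equation at infinity, with the sign for which it agrees with [dU]
    on the overlap. *)
Definition dV : V -> V := chart_der (fun=> 0) (- Ft w t) (Fw w t).

Let dV_eq0 : pre_chart_der (fun=> 0) (- Ft w t) (Fw w t) (weierV a2 a4 a6) = 0 :> V.
Proof.
by apply: chart_derV_eq0 => [|]; [exact: derivation0 | rewrite rmorph0; ring].
Qed.

Lemma dV_vf : vector_field str dV.
Proof.
split=> [|r]; first exact: (chart_derP (derivation0 R) dV_eq0).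
by rewrite [LHS](chart_der_str (derivation0 R) dV_eq0) rmorph0.
Qed.

Lemma dV_w : dV w = - Ft w t.
Proof. exact: chart_der_u (derivation0 R) dV_eq0. Qed.
Lemma dV_t : dV t = Fw w t.
Proof. exact: chart_der_v (derivation0 R) dV_eq0. Qed.

Let m := str h * vm (str a2) (str a4) (str a6) w t.

(** dx/(2y) continued across infinity; its coefficients are the cofactors of [vF_smooth]. *)
Definition omegaV : form V :=
  [:: (- m * t, w); (m * w - (1 + str a2 * t ^+ 2), t)].

Lemma dual_basisV : dual_basis str dV omegaV.
Proof.
have D0 := derivation0 R.
have h2' : 2 * str h = 1 by rewrite -(rmorph_nat str) -rmorphM h2 rmorph1.
apply: (@dual_basis_plane _ _ pV (Fw w t) (Ft w t) (-1)); last first.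
- by rewrite -[RHS](vF_smooth h2' weierV_eq) /m /Fw /Ft; ring.
- by rewrite -/t dV_t mulN1r opprK.
- by rewrite -/w dV_w mulN1r.
- exact: dV_vf.
- rewrite (der_along_weierV (pre_chart_der_der _ _ D0)) !pre_chart_derC //.
  by rewrite pre_chart_der_u // pre_chart_der_v // rmorph0 /Ft /vFt -/t -/w; ring.
- rewrite (der_along_weierV (pre_chart_der_der _ _ D0)) !pre_chart_derC //.
  by rewrite pre_chart_der_u // pre_chart_der_v // rmorph0 /Fw /vFw -/t -/w; ring.
Qed.

Section RamanujanV.
Variable v : R -> R.
Hypotheses (vP : @derivation R R^o v) (va2 : v a2 = a4) (va4 : v a4 = 6 * a6).
Hypothesis va6 : v a6 = 4 * a2 * a6 - a4 ^+ 2.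

Let b := vb (str a2) (str a4) (str a6) w t.

Definition DV : V -> V := chart_der v
  (vDw (str a2) (str a4) (str a6) w t) (vDt (str a2) (str a4) (str a6) w t).

Let DV_eq0 : pre_chart_der v (vDw (str a2) (str a4) (str a6) w t)
  (vDt (str a2) (str a4) (str a6) w t) (weierV a2 a4 a6) = 0 :> V.
Proof.
apply: chart_derV_eq0 => //; rewrite va2 va4 va6.
apply: (eq_mod (q := 2 * t ^+ 2 * str a2 ^+ 2 - 6 * t ^+ 2 * str a4
  + t * w * str a2 * str a4 - 9 * t * w * str a6 - 2 * str a2) weierV_eq).
by rewrite /Fw /Ft /vFw /vFt /vDw /vDt /vF; ring.
Qed.

Lemma DV_der : @derivation V V^o DV. Proof. exact: chart_derP vP DV_eq0. Qed.
Lemma DV_str r : DV (str r) = str (v r).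
Proof. exact: chart_der_str vP DV_eq0 r. Qed.
Lemma DV_w : DV w = vDw (str a2) (str a4) (str a6) w t.
Proof. exact: chart_der_u vP DV_eq0. Qed.
Lemma DV_t : DV t = vDt (str a2) (str a4) (str a6) w t.
Proof. exact: chart_der_v vP DV_eq0. Qed.

(** Hence L_D omega = b omega at infinity, which is the regular form eta - d(x^2/y). *)
Lemma DV_dV z : DV (dV z) - dV (DV z) = - b * dV z.
Proof.
have [dP d0] := dV_vf; have DP := DV_der.
have E := (der_along_sub (phi := idfun) (der_along_bracket DP dP)
  (der_along_scale (phi := idfun) (- b) dP)).
apply/eqP; rewrite -subr_eq0; apply/eqP; move: z.
apply: (der_along_chart0 E) => [r||].
- by rewrite DV_str !d0 (der_zero DP) scaler0 !subr0.
- rewrite -/w -[_ *: _]/(_ * _) DV_w dV_w /Ft /vFt /vDw.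
  rewrite !(derE DP, derE dP) dV_w dV_t DV_w DV_t !DV_str !d0 va2 va4.
  apply: (eq_mod (q := - 4 * t * str a2 ^+ 2 + 12 * t * str a4
    - w * str a2 * str a4 + 9 * w * str a6) weierV_eq).
  by rewrite /Fw /Ft /b /vb /vs /vFw /vFt /vDw /vDt /vF; ring.
- rewrite -/t -[_ *: _]/(_ * _) DV_t dV_t /Fw /vFw /vDt.
  rewrite !(derE DP, derE dP) dV_w dV_t DV_w DV_t !DV_str !d0 va2 va4 va6.
  apply: (eq_mod (q := t * str a2 * str a4 - 9 * t * str a6) weierV_eq).
  by rewrite /Fw /Ft /b /vb /vs /vFw /vFt /vDw /vDt /vF; ring.
Qed.

(** The left side is the coefficient of L_D (b omega), so this form is exact at infinity. *)
Lemma DV_b : DV b + b * b = dV (vh (str a2) (str a4) (str a6) w t).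
Proof.
have [dP d0] := dV_vf; have DP := DV_der.
rewrite /b /vb /vh /vs.
rewrite !(derE DP, derE dP) dV_w dV_t DV_w DV_t !DV_str !d0 va2 va4 va6.
apply: (eq_mod (q := - t * str a2 ^+ 2 * str a4 - 9 * t * str a2 * str a6
  + 6 * t * str a4 ^+ 2 - 2 * w * str a2 ^+ 2 * str a6 + 6 * w * str a4 * str a6)
  weierV_eq).
by rewrite /Fw /Ft /vFw /vFt /vDw /vDt /vF; ring.
Qed.

End RamanujanV.

End ChartV.

(** * The overlap *)

Section FormulasMorph.
Variables (C C' : comNzRingType) (f : {rmorphism C -> C'}) (c2 c4 c6 : C).

Lemma rmorph_cubic x : f (cubic c2 c4 c6 x) = cubic (f c2) (f c4) (f c6) (f x).
Proof. rewrite /cubic; ring. Qed.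
Lemma rmorph_dcubic x : f (dcubic c2 c4 x) = dcubic (f c2) (f c4) (f x).
Proof. rewrite /dcubic; ring. Qed.
Lemma rmorph_vFt w t : f (vFt c2 c4 w t) = vFt (f c2) (f c4) (f w) (f t).
Proof. rewrite /vFt; ring. Qed.
Lemma rmorph_vFw w t :
  f (vFw c2 c4 c6 w t) = vFw (f c2) (f c4) (f c6) (f w) (f t).
Proof. rewrite /vFw; ring. Qed.
Lemma rmorph_vDt w t :
  f (vDt c2 c4 c6 w t) = vDt (f c2) (f c4) (f c6) (f w) (f t).
Proof. rewrite /vDt; ring. Qed.
Lemma rmorph_vDw w t :
  f (vDw c2 c4 c6 w t) = vDw (f c2) (f c4) (f c6) (f w) (f t).
Proof. rewrite /vDw; ring. Qed.
Lemma rmorph_vb w t :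
  f (vb c2 c4 c6 w t) = vb (f c2) (f c4) (f c6) (f w) (f t).
Proof. rewrite /vb /vs; ring. Qed.
Lemma rmorph_vh w t :
  f (vh c2 c4 c6 w t) = vh (f c2) (f c4) (f c6) (f w) (f t).
Proof. rewrite /vh /vs; ring. Qed.

End FormulasMorph.

(* T stands for 1/y. *)
Section OverlapFormulas.
Variables (C : comNzRingType) (c2 c4 c6 x y T : C).
Hypotheses (yT : y * T = 1) (yy : y ^+ 2 = cubic c2 c4 c6 x).

Lemma overlap_y : y = T * cubic c2 c4 c6 x.
Proof. by rewrite -yy expr2 mulrA [T * y]mulrC yT mul1r. Qed.

(** Once y is replaced by T f(x), this is the one relation left, and it serves as the modulus in the
    identities below. *)
Lemma overlap_T : T ^+ 2 * cubic c2 c4 c6 x - 1 = 0.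
Proof. by rewrite -yy -exprMn mulrC mulrC [T * y]mulrC yT expr1n subrr. Qed.

Lemma overlap_dt :
  x * (- T ^+ 2 * dcubic c2 c4 x) + T * (2 * y) = vFw c2 c4 c6 T (x * T).
Proof.
rewrite overlap_y; apply: (eq_mod (q := -1) overlap_T).
by rewrite /vFw /dcubic /cubic; ring.
Qed.

Lemma overlap_dw : - T ^+ 2 * dcubic c2 c4 x = - vFt c2 c4 T (x * T).
Proof. rewrite /vFt /dcubic; ring. Qed.

(** Together with [overlap_Dw]: subtracting (x^2/y) d removes the pole of D at infinity, leaving
    polynomials in w and t. *)
Lemma overlap_Dt :
  x * (- T ^+ 2 * ((3 * x + 2 * c2) * y)) + T * (2 * x ^+ 2 + 2 * c2 * x + c4)
  - x ^+ 2 * T * (x * (- T ^+ 2 * dcubic c2 c4 x) + T * (2 * y)) =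
  vDt c2 c4 c6 T (x * T).
Proof.
apply: (eq_mod (q := x ^+ 2 * T - x * T * c2
  - x * T * (3 * x + 2 * c2)) overlap_T).
rewrite overlap_y /vDt /dcubic /cubic; ring.
Qed.

Lemma overlap_Dw :
  - T ^+ 2 * ((3 * x + 2 * c2) * y)
  - x ^+ 2 * T * (- T ^+ 2 * dcubic c2 c4 x) = vDw c2 c4 c6 T (x * T).
Proof.
apply: (eq_mod (q := 3 * x * T - T * (3 * x + 2 * c2)) overlap_T).
by rewrite overlap_y /vDw /dcubic /cubic; ring.
Qed.

(** The coefficients of eta = b omega + d(x^2/y), the decomposition that represents eta as a class
    of the second kind. *)
Lemma overlap_eta :
  x = vb c2 c4 c6 T (x * T)
      + (x ^+ 2 * (- T ^+ 2 * dcubic c2 c4 x) + T * (2 * x * (2 * y))).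
Proof.
apply/esym; rewrite overlap_y.
apply: (eq_mod (q := x + c2) overlap_T).
by rewrite /vb /vs /dcubic /cubic; ring.
Qed.

(** The overlap component of nabla eta, D(x^2/y) + (x^2/y) b, is a difference of functions regular
    on the two charts. *)
Lemma overlap_nabla_eta :
  x ^+ 2 * (- T ^+ 2 * ((3 * x + 2 * c2) * y))
  + T * (2 * x * (2 * x ^+ 2 + 2 * c2 * x + c4))
  + x ^+ 2 * T * vb c2 c4 c6 T (x * T) = y - vh c2 c4 c6 T (x * T).
Proof.
rewrite overlap_y.
apply: (eq_mod (q := x * T * c2 ^+ 2 - 2 * x * T * c4 - 3 * T * c6
  - T * x ^+ 2 * (3 * x + 2 * c2)) overlap_T).
by rewrite /vb /vh /vs /cubic; ring.
Qed.

End OverlapFormulas.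

Lemma deriv_inv (A : comNzRingType) (D : A -> A) (s T : A) :
  @derivation A A^o D -> s * T = 1 -> D T = - T ^+ 2 * D s.
Proof.
move=> DP sT; have := congr1 D sT.
rewrite (der_mul DP) (der_one DP) => /eqP; rewrite addr_eq0 => /eqP E.
rewrite -[LHS]mul1r -sT mulrAC mulrC E.
by ring.
Qed.

Section Overlap.
Variables (R : comNzRingType) (a2 a4 a6 h : R).
Hypothesis h2 : 2 * h = 1.
Variable X : two_charts R.
Variables (xU yU : chU X) (wV tV : chV X) (T : chW X).
Local Notation U := (chU X).
Local Notation V := (chV X).
Local Notation W := (chW X).
Local Notation rU := (resU X).
Local Notation rV := (resV X).
Local Notation str := (strW X).
Local Notation x := (rU xU).
Local Notation y := (rU yU).
Hypothesis yT : y * T = 1.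
Hypothesis yyU : yU ^+ 2 = cubic (strU X a2) (strU X a4) (strU X a6) xU.
Hypotheses (rVw : rV wV = T) (rVt : rV tV = x * T).
Hypothesis genV : forall (D : V -> V) (D' : W -> W),
  @derivation V V^o D -> @derivation W W^o D' ->
  (forall r, D' (rV (strV X r)) = rV (D (strV X r))) ->
  D' (rV wV) = rV (D wV) -> D' (rV tV) = rV (D tV) ->
  forall z, D' (rV z) = rV (D z).
Hypothesis genW : forall (M : lmodType W) (E : W -> M),
  derivation E -> (forall r, E (str r) = 0) -> E x = 0 -> E y = 0 ->
  forall z, E z = 0.

Let yy : y ^+ 2 = cubic (str a2) (str a4) (str a6) x.
Proof. by rewrite -rmorphXn yyU rmorph_cubic !resU_str. Qed.

Variables (dU : U -> U) (dV : V -> V) (dW : W -> W).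
Hypotheses (dU_vf : vector_field (strU X) dU) (dV_vf : vector_field (strV X) dV).
Hypotheses (dUx : dU xU = 2 * yU).
Hypotheses (dUy : dU yU = dcubic (strU X a2) (strU X a4) xU).
Hypotheses (dVw : dV wV = - vFt (strV X a2) (strV X a4) wV tV).
Hypotheses (dVt : dV tV = vFw (strV X a2) (strV X a4) (strV X a6) wV tV).
Hypotheses (dWP : @derivation W W^o dW) (dW_resU : forall z, dW (rU z) = rU (dU z)).

Let d0 r : dW (str r) = 0.
Proof. by rewrite -resU_str dW_resU dU_vf.2 rmorph0. Qed.

Lemma overlap_dW_x : dW x = 2 * y.
Proof. by rewrite dW_resU dUx rmorphM rmorph_nat. Qed.
Lemma overlap_dW_y : dW y = dcubic (str a2) (str a4) x.
Proof. by rewrite dW_resU dUy rmorph_dcubic !resU_str. Qed.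
Lemma overlap_dW_T : dW T = - T ^+ 2 * dcubic (str a2) (str a4) x.
Proof. by rewrite (deriv_inv dWP yT) overlap_dW_y. Qed.

Lemma overlap_dW_resV z : dW (rV z) = rV (dV z).
Proof.
have [eP e0] := dV_vf.
apply: (genV eP dWP) => [r||].
- by rewrite e0 rmorph0 resV_str d0.
- by rewrite rVw dVw rmorphN rmorph_vFt !resV_str rVw rVt overlap_dW_T -overlap_dw.
- rewrite rVt dVt rmorph_vFw !resV_str rVw rVt.
  by rewrite (der_mul dWP) overlap_dW_T overlap_dW_x (overlap_dt yT yy).
Qed.

Lemma dual_basisW : dual_basis str dW [:: (str h * T, x)].
Proof.
have h2' : 2 * str h = 1 by rewrite -(rmorph_nat str) -rmorphM h2 rmorph1.
have o1 : str h * T * (2 * y) = 1.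
  transitivity (2 * str h * (y * T)); first by ring.
  by rewrite h2' yT mulr1.
split; first by split=> // r; exact: d0.
  by rewrite /form_val big_seq1 /= overlap_dW_x; exact: o1.
move=> M dl [dlP dl0] z; rewrite /form_val big_seq1 /=.
set c := str h * T.
apply/eqP; rewrite -subr_eq0; apply/eqP; move: z.
have := der_along_sub (phi := idfun) dlP
  (der_along_mulr (phi := idfun) (c *: dl x) dWP).
set E := (fun _ => _) => EP.
have Estr r : E (str r) = 0 by rewrite /E dl0 d0 scale0r subrr.
have Ex : E x = 0 by rewrite /E overlap_dW_x scalerA [_ * c]mulrC o1 scale1r subrr.
apply: (genW EP) => //.
(* The value at y is reached through y^2 = f(x): 2 y E y = 0, and [c] is the inverse of 2 y. *)
have: E (y ^+ 2) = 0.
  rewrite yy /cubic !EP.1 !(EP.2 (str _)) !(der_alongX (phi := idfun) EP) !Estr Ex.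
  by rewrite !scaler0 !mul0rn !scaler0 !addr0.
rewrite (der_alongX (phi := idfun) EP) expr1 scalerMnl.
move=> /(congr1 (fun m => c *: m)); rewrite scaler0 scalerA -mulr_natl.
by rewrite o1 scale1r.
Qed.

Variable v : R -> R.
Hypotheses (va2 : v a2 = a4) (va4 : v a4 = 6 * a6).
Hypothesis va6 : v a6 = 4 * a2 * a6 - a4 ^+ 2.
Variables (DU : U -> U) (DV : V -> V) (DW : W -> W).
Hypotheses (DUP : @derivation U U^o DU) (DVP : @derivation V V^o DV).
Hypotheses (DU_str : forall r, DU (strU X r) = strU X (v r)).
Hypotheses (DV_str : forall r, DV (strV X r) = strV X (v r)).
Hypothesis DU_x : DU xU = 2 * xU ^+ 2 + 2 * strU X a2 * xU + strU X a4.
Hypothesis DU_y : DU yU = (3 * xU + 2 * strU X a2) * yU.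
Hypothesis DV_w : DV wV = vDw (strV X a2) (strV X a4) (strV X a6) wV tV.
Hypothesis DV_t : DV tV = vDt (strV X a2) (strV X a4) (strV X a6) wV tV.
Hypotheses (DWP : @derivation W W^o DW) (DW_resU : forall z, DW (rU z) = rU (DU z)).

(** The field D - (x^2/y) d on the overlap, which is the restriction of [DV]. *)
Let DW' z := DW z - x ^+ 2 * T * dW z.

Let DW'P : @derivation W W^o DW'.
Proof.
exact: (der_along_sub (phi := idfun) DWP
  (der_along_scale (phi := idfun) (x ^+ 2 * T) dWP)).
Qed.

Let DW_str r : DW (str r) = str (v r).
Proof. by rewrite -!resU_str DW_resU DU_str. Qed.
Let DW_x : DW x = 2 * x ^+ 2 + 2 * str a2 * x + str a4.
Proof.
by rewrite DW_resU DU_x -!resU_str; ring.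
Qed.
Let DW_y : DW y = (3 * x + 2 * str a2) * y.
Proof.
by rewrite DW_resU DU_y -!resU_str; ring.
Qed.
Let DW_T : DW T = - T ^+ 2 * ((3 * x + 2 * str a2) * y).
Proof. by rewrite (deriv_inv DWP yT) DW_y. Qed.

Let DW'_resV z : DW' (rV z) = rV (DV z).
Proof.
apply: (genV DVP DW'P) => [r||].
- by rewrite DV_str !resV_str /DW' DW_str d0 mulr0 subr0.
- rewrite rVw DV_w rmorph_vDw !resV_str rVw rVt.
  by rewrite /DW' DW_T overlap_dW_T (overlap_Dw yT yy).
- rewrite rVt DV_t rmorph_vDt !resV_str rVw rVt /DW'.
  rewrite (der_mul DWP) (der_mul dWP) DW_T overlap_dW_T DW_x overlap_dW_x.
  by rewrite (overlap_Dt yT yy).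
Qed.

Variables (oU : form U) (oV : form V).
Hypotheses (dbU : dual_basis (strU X) dU oU) (dbV : dual_basis (strV X) dV oV).
Let b := vb (strV X a2) (strV X a4) (strV X a6) wV tV.
Let hV := vh (strV X a2) (strV X a4) (strV X a6) wV tV.
Hypothesis DU_dU : forall z, DU (dU z) - dU (DU z) = - xU * dU z.
Hypothesis DV_dV : forall z, DV (dV z) - dV (DV z) = - b * dV z.
Hypothesis DV_b : DV b + b * b = dV hV.

(** The cochains are zw = (omega, omega, 0) and ze = (x omega, b omega, x^2/y). With the lifts [DU]
    and [DV], nabla zw has the same components as ze, and nabla ze is the coboundary of (y, vh). *)
Lemma ramanujan_cochains : exists zw ze : cochain X,
  [/\ second_kind_class [:: (str h * T, x)] zw,
      second_kind_class [:: (x * str h * T, x)] ze,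
      gauss_manin v zw ze & gauss_manin v ze (cochain0 X)].
Proof.
have dbW := dual_basisW.
have scU (p q : U) : p *: (q : U^o) = p * q by [].
have scV (p q : V) : p *: (q : V^o) = p * q by [].
have scW (p q : W) : p *: (q : W^o) = p * q by [].
have [_ vU _] := dbU; have [_ vV _] := dbV; have [_ vW _] := dbW.
have mapU s : @form_val W W^o dW (form_map rU s) = rU (@form_val U U^o dU s).
  exact: form_val_map.
have mapV s : @form_val W W^o dW (form_map rV s) = rV (@form_val V V^o dV s).
  exact: (form_val_map _ overlap_dW_resV).
have rVb : rV b = vb (str a2) (str a4) (str a6) T (x * T).
  by rewrite rmorph_vb !resV_str rVw rVt.
have rVh : rV hV = vh (str a2) (str a4) (str a6) T (x * T).
  by rewrite rmorph_vh !resV_str rVw rVt.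
have vU1 : @form_val U U^o dU (form_scale xU oU) = xU.
  by rewrite form_val_scale vU scU mulr1.
have vV1 : @form_val V V^o dV (form_scale b oV) = b.
  by rewrite form_val_scale vV scV mulr1.
pose k := x ^+ 2 * T.
have dk : dW k = x ^+ 2 * (- T ^+ 2 * dcubic (str a2) (str a4) x)
    + T * (2 * x * (2 * y)).
  by rewrite /k (der_mul dWP) overlap_dW_T (der_exp dWP) expr1 overlap_dW_x.
have Dk : DW k + k * rV b = y - rV hV.
  rewrite rVh -(overlap_nabla_eta yT yy) -rVb /k (der_mul DWP) (der_exp DWP).
  by rewrite DW_T DW_x expr1.
(* The two lifts differ by (x^2/y) d on the overlap, so the contraction term multiplies the
   coefficient of the form by k = x^2/y. *)
have contr s : @form_val W W^o (fun c => DW c - DW' c) (form_map rV s) =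
    k * rV (@form_val V V^o dV s).
  rewrite -mapV /form_val [RHS]mulr_sumr; apply: eq_bigr => p _.
  by rewrite /DW' subKr !scW mulrCA.
have lieU := form_val_lie (D := DU) _ DUP DU_dU.
have lieV := form_val_lie (D := DV) _ DVP DV_dV.
have DU1 : DU 1 = 0 by exact: der_one.
have DV1 : DV 1 = 0 by exact: der_one.
have dU0 : dU 0 = 0 by exact: (der_zero dU_vf.1).
have dV0 : dV 0 = 0 by exact: (der_zero dV_vf.1).
have DW0 : DW 0 = 0 by exact: der_zero.
exists (@Cochain R X oU oV 0), (@Cochain R X (form_scale xU oU) (form_scale b oV) k).
split; [split | split | exists DU, DV, DW, DW' | exists DU, DV, DW, DW'].
- apply/(form_eq_dual dbW); rewrite form_val_cat form_val_d mapU mapV vU vV.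
  by rewrite !rmorph1 (der_zero dWP) addr0.
- by apply/(form_eq_dual dbW); rewrite mapU vU vW rmorph1.
- apply/(form_eq_dual dbW); rewrite form_val_cat form_val_d mapU mapV vU1 vV1.
  by rewrite dk rVb; exact: (overlap_eta yT yy).
- apply/(form_eq_dual dbW); rewrite mapU vU1 -[LHS]mulr1 -vW.
  by rewrite /form_val !big_seq1 /= !scW !mulrA.
- split=> //; exists 0, 0; split.
  + apply/(form_eq_dual dbU); rewrite form_val_cat form_val_d lieU vU vU1.
    by rewrite DU1 dU0 /=; ring.
  + apply/(form_eq_dual dbV); rewrite form_val_cat form_val_d lieV vV vV1.
    by rewrite DV1 dV0 /=; ring.
  + by rewrite /= contr vV !rmorph0 DW0 rmorph1; ring.
- split=> //; exists yU, hV; split.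
  + apply/(form_eq_dual dbU); rewrite form_val_cat form_val_d lieU vU1 dUy.
    by rewrite /form_val /= big_nil DU_x /dcubic; ring.
  + apply/(form_eq_dual dbV); rewrite form_val_cat form_val_d lieV vV1 -DV_b.
    by rewrite /form_val /= big_nil; ring.
  + by rewrite /= contr vV1 Dk add0r.
Qed.

End Overlap.

(** * Uniqueness *)

Section CubicPoly.
Variables (R : comNzRingType) (a2 a4 a6 : R).

Definition cubicp : {poly R} := cubic a2%:P a4%:P a6%:P 'X.

Lemma cubicpE : cubicp = 'X^3 + a2%:P * 'X^2 + a4%:P * 'X + a6%:P.
Proof. by []. Qed.

Lemma deriv_cubicp : cubicp^`() = dcubic a2%:P a4%:P 'X.
Proof.
rewrite /cubicp /cubic /dcubic !derivD !(derivM _%:P) !derivC !derivXn derivX /=.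
by ring.
Qed.

Lemma size_cubicp : size cubicp = 4%N.
Proof.
rewrite cubicpE -!addrA size_polyDl size_polyXn //.
rewrite ltnS; apply: (leq_trans (size_polyD _ _)); rewrite geq_max.
apply/andP; split.
  apply: leq_trans (size_polyMleq _ _) _; rewrite size_polyXn.
  by have := size_polyC_leq1 a2; case: (size _) => [|[|?]].
apply: (leq_trans (size_polyD _ _)); rewrite geq_max.
rewrite (leq_trans (size_polyC_leq1 _)) // andbT.
apply: leq_trans (size_polyMleq _ _) _; rewrite size_polyX.
by have := size_polyC_leq1 a4; case: (size _) => [|[|?]].
Qed.

Lemma monic_cubicp : cubicp \is monic.
Proof.
rewrite monicE lead_coefE size_cubicp cubicpE !coefD !coefCM !coefXn coefX coefC /=.
by rewrite !mulr0 !addr0.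
Qed.

Lemma coef_mul_top (p q : {poly R}) m n :
  (size p <= m.+1)%N -> (size q <= n.+1)%N -> (p * q)`_(m + n) = p`_m * q`_n.
Proof.
move=> sp sq; rewrite coefM (bigD1 (inord m)) //= inordK ?ltnS ?leq_addr //.
rewrite addKn big1 ?addr0 // => i.
rewrite -val_eqE /= inordK ?ltnS ?leq_addr // neq_ltn => /orP [im|mi].
  by rewrite [q`__]nth_default ?mulr0 // (leq_trans sq) // ltn_subRL ltn_add2r.
by rewrite [p`__]nth_default ?mul0r // (leq_trans sp).
Qed.

Lemma coef_mul_deriv_cubicp (p : {poly R}) n : (size p <= n.+1)%N ->
  (p * cubicp^`())`_n.+2 = p`_n *+ 3.
Proof.
move=> sp; rewrite -[n.+2]addn2 coef_mul_top //; last first.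
  by rewrite -ltnS -size_cubicp lt_size_deriv // -size_poly_eq0 size_cubicp.
rewrite coef_deriv; have := monic_cubicp.
by rewrite monicE lead_coefE size_cubicp /= => /eqP ->; rewrite mulrnAr mulr1.
Qed.

Lemma coef_deriv_mul_cubicp (p : {poly R}) n : (size p <= n.+1)%N ->
  (p^`() * cubicp)`_n.+2 = p`_n *+ n.
Proof.
case: n => [|n] sp.
  by rewrite [p]size1_polyC // derivC mul0r coef0.
rewrite -[n.+3]addn3 coef_mul_top ?size_cubicp //; last first.
  apply/leq_sizeP => j nj; rewrite coef_deriv nth_default ?mul0rn //.
  exact: leq_trans sp _.
rewrite coef_deriv; have := monic_cubicp.
by rewrite monicE lead_coefE size_cubicp /= => /eqP ->; rewrite mulr1.
Qed.

(* Leading coefficients: [2 A' f - A f'] and [2 Q' f + Q f'] have degree two  *)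
(* more than A and Q, with leading factors 2n - 3 and 2n + 3.                 *)
Lemma cubic_ode_eq0 (A Q : {poly R}) (c2 c4 c6 : R) : torsion_free R ->
  A = 2 * Q^`() * cubicp + Q * cubicp^`() ->
  2 * A^`() * cubicp =
    A * cubicp^`() + (c2%:P * 'X^2 + c4%:P * 'X + c6%:P) ->
  [/\ c2 = 0, c4 = 0 & c6 = 0].
Proof.
move=> tf EA EA'.
have coefA n : (n > 0)%N -> (size A <= n.+1)%N -> A`_n = 0.
  move=> n_gt0 sA; have := congr1 (coefp n.+2) EA'.
  rewrite /= -mulrA mulr_natl coefMn coef_deriv_mul_cubicp // coefD.
  rewrite coef_mul_deriv_cubicp // !coefD !coefCM coefXn coefX coefC.
  case: n n_gt0 sA => // n _ sA; rewrite /= !mulr0 !addr0 -mulrnA.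
  (* Here the degree is n + 1. In degree one 2n - 3 is negative, so 2 a = 3 a is cancelled by hand;
     from degree two on, the difference of multiplicities is a positive natural number. *)
  case: n sA => [|n] sA.
    by rewrite mulrS [in RHS]mulrS [in RHS]mulrS; move/addrI => /eqP;
      rewrite mulr1n -[X in X == _]addr0 => /eqP/addrI/esym.
  move=> /eqP; rewrite -subr_eq0 -mulrnBr; last by rewrite muln2 !doubleS.
  by rewrite muln2 !doubleS subSS subSS subSS => /eqP/tf.
have A0 : (size A <= 1)%N.
  rewrite leqNgt; apply/negP => sA.
  have := coefA (size A).-1; rewrite -lead_coefE -subn1 subn_gt0 sA.
  rewrite subn1 prednK ?(ltn_trans _ sA) // leqnn => /(_ isT isT) /eqP.
  by rewrite lead_coef_eq0 => /eqP A0; rewrite A0 size_poly0 in sA.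
(* A is constant, whereas a nonzero Q of degree n would give it the coefficient (2n + 3) lead(Q) in
   degree n + 2. *)
have Q0 : Q = 0.
  apply/eqP/negPn/negP => Qn0; have := congr1 (coefp (size Q).-1.+2) EA.
  have sQ : (size Q <= (size Q).-1.+1)%N by exact: leqSpred.
  rewrite /= coefD -mulrA mulr_natl coefMn coef_deriv_mul_cubicp //.
  rewrite coef_mul_deriv_cubicp // nth_default ?(leq_trans A0) // -mulrnA -mulrnDr.
  rewrite -lead_coefE addn3 => /esym/tf/eqP; rewrite lead_coef_eq0.
  exact/negP.
have E0 : c2%:P * 'X^2 + c4%:P * 'X + c6%:P = 0.
  move: EA'; rewrite EA Q0 deriv0 mulr0 !mul0r addr0 deriv0 mulr0 !mul0r add0r.
  by move=> /esym.
have cE i : c2 * (i == 2%N)%:R + c4 * (i == 1%N)%:R + (if i == 0%N then c6 else 0) = 0.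
  by have := congr1 (coefp i) E0; rewrite /= !coefD !coefCM coefXn coefX coefC coef0.
split; [have := cE 2%N | have := cE 1%N | have := cE 0%N];
  by rewrite /= ?mulr0 ?mulr1 ?addr0 ?add0r.
Qed.

End CubicPoly.

Section Uniqueness.
Variables (R U : comNzRingType) (str : {rmorphism R -> U}) (a2 a4 a6 : R).
Variables (iU : {rmorphism {poly R} -> U}) (y : U).
Hypothesis iUC : forall r, iU r%:P = str r.
Let x := iU 'X.
Hypothesis yy : y ^+ 2 = iU (cubicp a2 a4 a6).
Hypothesis decomp : forall z, exists P Q, z = iU P + iU Q * y.
Hypothesis uniq : forall P Q, iU P + iU Q * y = 0 -> P = 0 /\ Q = 0.
Variables (d : U -> U).
Hypothesis d_vf : vector_field str d.
Hypotheses (dx : d x = 2 * y) (dy : d y = iU (cubicp a2 a4 a6)^`()).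

Let f := cubicp a2 a4 a6.

Let dP : @derivation U U^o d := d_vf.1.

Lemma der_polyE (E : U -> U) (e : R -> R) : @derivation U U^o E ->
  (forall r, E (str r) = str (e r)) -> (forall r, e r = 0) ->
  forall P, E (iU P) = iU P^`() * E x.
Proof.
move=> EP Ee e0; elim/poly_ind => [|p c IH].
  by rewrite deriv0 rmorph0 mul0r (der_zero EP).
rewrite rmorphD rmorphM (der_add EP) (der_mul EP) IH iUC Ee e0 rmorph0 addr0.
by rewrite derivD derivM derivX derivC addr0 mulr1 rmorphD rmorphM -/x; ring.
Qed.

Let d_poly P : d (iU P) = iU P^`() * (2 * y).
Proof.
rewrite (@der_polyE d (fun=> 0)) ?dx // => r; by rewrite d_vf.2 rmorph0.
Qed.

(** Multiplication by y sends P + Q y to Q f + P y, and f is monic. *)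
Lemma nonzerodivisor_y z : y * z = 0 -> z = 0.
Proof.
have [P [Q ->]] := decomp z.
have -> : y * (iU P + iU Q * y) = iU (Q * f) + iU P * y.
  by rewrite rmorphM -yy; ring.
move=> /uniq [Qf ->]; rewrite rmorph0 add0r.
suff -> : Q = 0 by rewrite rmorph0 mul0r.
apply/eqP; have := Qf => /eqP.
by rewrite mulIr_eq0 //; apply/monic_rreg/monic_cubicp.
Qed.

(** Writing E x = d g as A + B y, commutation gives 2 E y = E (d x) = d (E x). Comparing y (2 E y)
    with E (f(x)), the part free of y is the equation of [cubic_ode_eq0]. *)
Lemma commuting_lift_eq0 (e : R -> R) (E : U -> U) (g : U) : torsion_free R ->
  @derivation U U^o E -> (forall r, E (str r) = str (e r)) ->
  E (d x) = d (E x) -> E x = d g -> [/\ e a2 = 0, e a4 = 0 & e a6 = 0].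
Proof.
move=> tf EP Ee Ed Eg; have [P [Q gE]] := decomp g.
pose A := 2 * Q^`() * f + Q * f^`(); pose B := 2 * P^`().
have Ex : E x = iU A + iU B * y.
  rewrite Eg gE (der_add dP) (der_mul dP) !d_poly dy /A /B rmorphD !rmorphM.
  rewrite /f -yy rmorph_nat; ring.
have Ey : 2 * E y = iU (2 * B^`() * f + B * f^`()) + iU (2 * A^`()) * y.
  have -> : 2 * E y = E (d x) by rewrite dx (der_mul EP) (der_nat EP); ring.
  rewrite Ed Ex (der_add dP) (der_mul dP) !d_poly dy rmorphD !rmorphM.
  rewrite /f -yy !rmorph_nat; ring.
have Eyy : y * (2 * E y) = iU f^`() * E x
    + iU ((e a2)%:P * 'X^2 + (e a4)%:P * 'X + (e a6)%:P).
  have <- : E (y ^+ 2) = y * (2 * E y) by rewrite (der_exp EP); ring.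
  have iUX n : iU 'X^n = x ^+ n by rewrite rmorphXn.
  rewrite yy /f deriv_cubicp (rmorph_dcubic iU) (rmorph_cubic iU) /cubic.
  rewrite !(rmorphD iU) !(rmorphM iU _%:P) !iUX !iUC -/x /dcubic.
  rewrite !(der_add EP) !(der_mul EP (str _)) !(der_exp EP) !Ee; ring.
have ode : iU (2 * A^`() * f
    - (A * f^`() + ((e a2)%:P * 'X^2 + (e a4)%:P * 'X + (e a6)%:P)))
  + iU (2 * B^`() * f) * y = 0.
  move: Eyy; rewrite Ey Ex => /eqP; rewrite -subr_eq0 => /eqP <-.
  have y0 : y ^+ 2 - iU f = 0 by rewrite yy subrr.
  by apply: (eq_mod (q := - 2 * iU A^`()) y0); move: f => F; ring.
have [/eqP + _] := uniq ode; rewrite subr_eq0 => /eqP.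
exact: cubic_ode_eq0.
Qed.

End Uniqueness.

Section GaussManinUniqueness.
Variables (R : comNzRingType) (X : two_charts R) (a2 a4 a6 : R).
Local Notation U := (chU X).
Local Notation W := (chW X).
Local Notation str := (strU X).
Variables (iU : {rmorphism {poly R} -> U}) (y : U).
Hypothesis iUC : forall r, iU r%:P = str r.
Let x := iU 'X.
Hypothesis yy : y ^+ 2 = iU (cubicp a2 a4 a6).
Hypothesis decomp : forall z, exists P Q, z = iU P + iU Q * y.
Hypothesis uniq : forall P Q, iU P + iU Q * y = 0 -> P = 0 /\ Q = 0.
Variables (d : U -> U) (dW : W -> W) (oU : form U) (oW eW : form W).
Hypotheses (dx : d x = 2 * y) (dy : d y = iU (cubicp a2 a4 a6)^`()).
Hypotheses (dbU : dual_basis str d oU) (dbW : dual_basis (strW X) dW oW).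
Hypothesis dW_resU : forall z, dW (resU X z) = resU X (d z).
Hypothesis eWE : @form_val W W^o dW eW = resU X x.
Hypothesis injU : forall z, resU X z = 0 -> z = 0.
Hypothesis tf : torsion_free R.

Variables (v0 : R -> R) (D0 : U -> U).
Hypotheses (D0P : @derivation U U^o D0) (D0_str : forall r, D0 (str r) = str (v0 r)).
Hypothesis D0x : D0 x = 2 * x ^+ 2 + 2 * str a2 * x + str a4.
Hypothesis D0_d : forall z, D0 (d z) - d (D0 z) = - x * d z.

Let dP : @derivation U U^o d. Proof. by case: dbU => [[]]. Qed.
Let d0 r : d (str r) = 0. Proof. by case: dbU => [[_ ->]]. Qed.

(** The values of [d] generate the unit ideal, since [oU] pairs with [d] to 1. *)
Let cancel_d c c' : (forall a, c * d a = c' * d a) -> c = c'.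
Proof.
move=> cd; have [_ o1 _] := dbU.
rewrite -[c]mulr1 -[c']mulr1 -o1 /form_val !mulr_sumr; apply: eq_bigr => p _.
by rewrite -[_ *: _]/(_ * _) !mulrA ![_ * p.1]mulrC -!mulrA cd.
Qed.

Let rel_derE (E : U -> U) : @rel_derivation R U str U^o E ->
  exists k, forall a, E a = k * d a.
Proof.
move=> ER; have [_ _ dU] := dbU; exists (@form_val U U^o E oU) => a.
by rewrite (dU U^o E ER) mulrC.
Qed.

Let bracket_d (D : U -> U) (e : R -> R) : @derivation U U^o D ->
  (forall r, D (str r) = str (e r)) -> exists m, forall a, D (d a) - d (D a) = m * d a.
Proof.
move=> DP De; apply: (rel_derE (E := fun a => D (d a) - d (D a))).
split; first exact: der_along_bracket.
by move=> r; rewrite d0 De d0 (der_zero DP) subrr.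
Qed.

(** The two connection equations may come with different lifts D1 and D2 of v, but these differ by k
    d. Expressed through D1, they give its bracket with [d] and its value at x up to exact terms. *)
Lemma gauss_manin_unique (v : R -> R) (zw ze : cochain X) :
  second_kind_class oW zw -> second_kind_class eW ze ->
  gauss_manin v zw ze -> gauss_manin v ze (cochain0 X) ->
  [/\ v a2 = v0 a2, v a4 = v0 a4 & v a6 = v0 a6].
Proof.
have d_vf : vector_field str d by case: dbU.
move=> [_ /(form_eq_dual dbW)]; rewrite (form_val_map _ dW_resU).
have [_ -> _] := dbW => ow.
have {}ow : @form_val U U^o d (onU zw) = 1.
  by apply/eqP; rewrite -subr_eq0; apply/eqP/injU; rewrite rmorphB ow rmorph1 subrr.
move=> [_ /(form_eq_dual dbW)]; rewrite (form_val_map _ dW_resU) eWE => oe.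
have {}oe : @form_val U U^o d (onU ze) = x.
  by apply/eqP; rewrite -subr_eq0; apply/eqP/injU; rewrite rmorphB oe subrr.
move=> [D1 [? [? [? [[D1P _ _ _] [D1s _] _]]]]] [g1 [? []]] /(form_eq_dual dbU) + _ _.
have [m1 D1d] := bracket_d D1P D1s.
rewrite (form_val_lie _ D1P D1d) form_val_cat form_val_d ow oe (der_one D1P) => E1.
move=> [D2 [? [? [? [[D2P _ _ _] [D2s _] _]]]]] [g2 [? []]] /(form_eq_dual dbU) + _ _.
have [m2 D2d] := bracket_d D2P D2s.
rewrite (form_val_lie _ D2P D2d) form_val_cat form_val_d oe /form_val big_nil => E2.
have [k D21] : exists k, forall a, D2 a - D1 a = k * d a.
  apply: (rel_derE (E := fun a => D2 a - D1 a)).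
  split; first exact: (der_along_sub (phi := idfun) D2P D1P).
  by move=> r; rewrite D2s D1s subrr.
have m1E : m1 = - x - d g1.
  by move: E1; rewrite mulr1 sub0r => /(congr1 -%R); rewrite opprK opprD.
have m2E : m2 = m1 - d k.
  apply: cancel_d => a; rewrite -D2d mulrBl -D1d.
  have D2E b : D2 b = D1 b + k * d b by rewrite -D21 addrC subrK.
  by rewrite !D2E (der_add dP) (der_mul dP); ring.
(* Since [D1, d] = - (x + d g1) d and [D0, d] = - x d, subtracting g1 d makes E commute with [d]. *)
pose E a := (D1 a - D0 a) - g1 * d a.
have EP : @derivation U U^o E.
  exact: (der_along_sub (phi := idfun) (der_along_sub (phi := idfun) D1P D0P)
    (der_along_scale (phi := idfun) g1 dP)).
have Es r : E (str r) = str (v r - v0 r).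
  by rewrite /E D1s D0_str d0 mulr0 subr0 rmorphB.
have Ed a : E (d a) = d (E a).
  rewrite /E !(der_add dP) !(der_opp dP) (der_mul dP).
  have -> : D1 (d a) = d (D1 a) + m1 * d a by rewrite -D1d addrC subrK.
  have -> : D0 (d a) = d (D0 a) - x * d a by rewrite -mulNr -D0_d addrC subrK.
  by rewrite m1E; ring.
(* The terms in k and g1 assemble into derivatives of products with x; the rest is - x^2 - D0 x = -
   f'(x) = - d y. *)
have Ex : E x = d (g2 - x * k - x * g1 - y).
  have D1x : D1 x = d g2 + m2 * x - k * d x.
    by rewrite -D21; move: E2; rewrite add0r => <-; ring.
  rewrite /E D1x D0x m2E m1E !(der_add dP) !(der_opp dP) !(der_mul dP) dx dy.
  rewrite deriv_cubicp (rmorph_dcubic iU) !iUC -/x /dcubic; ring.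
have [] := commuting_lift_eq0 iUC yy decomp uniq d_vf dx dy tf EP Es (Ed _) Ex.
by move=> /eqP + /eqP + /eqP; rewrite !subr_eq0 => /eqP -> /eqP -> /eqP ->.
Qed.

End GaussManinUniqueness.

(** * The Weierstrass curve *)

Section WeierRingU.
Variables (R : comNzRingType) (a2 a4 a6 : R).
Variable pU : proper_gen (weierU a2 a4 a6).

Definition polyU : {rmorphism {poly R} -> chart pU} := cls pU \o polyC.
Local Notation y := (chart_v pU).

Lemma polyU_sqr : y ^+ 2 = polyU (cubicp a2 a4 a6).
Proof. by rewrite weierU_eq (rmorph_cubic polyU). Qed.

(** With [polyU_uniq]: the affine ring is free over R[x] with basis 1, y, by division by the monic
    quadratic in y. *)
Lemma polyU_decomp z : exists P Q, z = polyU P + polyU Q * y.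
Proof.
rewrite -(cls_repr z); elim/poly_ind: (repr z) => [|p c [P [Q E]]].
  by exists 0, 0; rewrite !rmorph0 mul0r addr0.
exists (Q * cubicp a2 a4 a6 + c), P.
rewrite (rmorphD (cls pU)) (rmorphM (cls pU)) E (rmorphD polyU) (rmorphM polyU).
by rewrite -polyU_sqr -[cls pU 'X]/y -[cls pU c%:P]/(polyU c); ring.
Qed.

Lemma polyU_uniq P Q : polyU P + polyU Q * y = 0 -> P = 0 /\ Q = 0.
Proof.
rewrite -[polyU P]/(cls pU P%:P) -[polyU Q]/(cls pU Q%:P) -[y]/(cls pU 'X).
rewrite -(rmorphM (cls pU)) -(rmorphD (cls pU)) -(rmorph0 (cls pU)).
move=> /cls_eq [q' /= E']; have [q E] : exists q : {poly {poly R}},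
  P%:P + Q%:P * 'X = q * weierU a2 a4 a6 by exists q'; rewrite -E' subr0.
have szF : size (weierU a2 a4 a6) = 3%N.
  rewrite /weierU size_polyDl ?size_polyXn // size_polyN.
  by apply: leq_ltn_trans (size_polyC_leq1 _) _.
have mF : weierU a2 a4 a6 \is monic.
  rewrite monicE lead_coefE szF /weierU coefB coefXn coefC /=.
  by rewrite subr0.
have q0 : q = 0.
  apply/eqP/negPn/negP => qn0.
  have : (size (q * weierU a2 a4 a6)%R <= 2)%N.
    rewrite -E addrC size_MXaddC; case: ifP => // _.
    by rewrite ltnS size_polyC_leq1.
  rewrite size_Mmonic // szF addn3 /= ltnS ltnS leqn0 size_poly_eq0.
  exact/negP.
move: E; rewrite q0 mul0r => E.
have := (congr1 (coefp 0) E, congr1 (coefp 1) E).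
rewrite /= !coefD !coefMX !coefC /= !addr0 add0r.
by case.
Qed.

(** Inverting y is injective because y is a nonzerodivisor. *)
Lemma weier_resU_inj (pW : proper_gen (loc_rel (weier_yU pU))) z :
  weier_resU pW z = 0 -> z = 0.
Proof.
move=> /inloc_eq0 [n]; elim: n => [|n IH]; first by rewrite expr0 mul1r.
rewrite exprS -mulrA => /(nonzerodivisor_y polyU_sqr polyU_decomp polyU_uniq).
exact: IH.
Qed.

End WeierRingU.

Lemma form_val_mul1 (A : comNzRingType) (dl : A -> A) (c p q g : A) :
  @form_val A A^o dl [:: (c * p * q, g)] = c * @form_val A A^o dl [:: (p * q, g)].
Proof. by rewrite /form_val !big_seq1 -mulrA -scalerA. Qed.

Section WeierCurve.
Variables (R : comNzRingType) (a2 a4 a6 h di : R).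
Hypotheses (h2 : 2 * h = 1) (disc1 : cubic_disc a2 a4 a6 * di = 1).
Variables (pU : proper_gen (weierU a2 a4 a6)) (pV : proper_gen (weierV a2 a4 a6)).
Variable pW : proper_gen (loc_rel (weier_yU pU)).
Variable v0 : R -> R.
Hypotheses (v0P : @derivation R R^o v0) (va2 : v0 a2 = a4) (va4 : v0 a4 = 6 * a6).
Hypothesis va6 : v0 a6 = 4 * a2 * a6 - a4 ^+ 2.

Let X := weier_curve pV pW.
Let dUP := (dU_vf pU).1.
Let DUP := DU_der pU v0P va2 va4 va6.
Let dW := loc_der (ps := pW) (dU (pU := pU)).
Let dWP := (loc_derP pW dUP).1.
Let dWE := (loc_derP pW dUP).2.
Let DWP := (loc_derP pW DUP).1.
Let DWE := (loc_derP pW DUP).2.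

Let rVw : weier_resV pV pW (chart_u pV) = locinv pW.
Proof. by rewrite /weier_resV liftE /ev2 evC evX. Qed.
Let rVt : weier_resV pV pW (chart_v pV) = weier_x pW * locinv pW.
Proof. by rewrite /weier_resV liftE /ev2 evX. Qed.

Let genW (M : lmodType (loc pW)) (E : loc pW -> M) : derivation E ->
  (forall r, E (weier_strW pW r) = 0) -> E (inloc pW (chart_u pU)) = 0 ->
  E (inloc pW (chart_v pU)) = 0 -> forall z, E z = 0.
Proof.
move=> EP Er Ex Ey; apply: (der_along_loc0 (phi := idfun) EP).
exact: (der_along_chart0 (phi := inloc pW) (der_along_comp (inloc pW) EP)).
Qed.

Let dbW : dual_basis (weier_strW pW) dW (weier_omega pV pW h).
Proof.
exact: (@dual_basisW R a2 a4 a6 h h2 X (chart_u pU) (chart_v pU) (locinv pW)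
  (mul_locinv pW) (weierU_eq pU) genW (dU (pU := pU)) dW (dU_vf pU)
  (dU_x pU) dWP dWE).
Qed.

Lemma weier_gauss_manin : exists zw ze : cochain X,
  [/\ second_kind_class (weier_omega pV pW h) zw,
      second_kind_class (weier_eta pV pW h) ze,
      gauss_manin v0 zw ze & gauss_manin v0 ze (cochain0 X)].
Proof.
exact: (@ramanujan_cochains R a2 a4 a6 h h2 X (chart_u pU) (chart_v pU)
  (chart_u pV) (chart_v pV) (locinv pW)
  (mul_locinv pW) (weierU_eq pU) rVw rVt
  (@chart_intertwine R _ pV _ (weier_resV pV pW)) genW
  (dU (pU := pU)) (dV (pV := pV)) dW (dU_vf pU) (dV_vf pV)
  (dU_x pU) (dU_y pU) (dV_w pV) (dV_t pV) dWP dWE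
  v0 (DU v0) (DV v0) (loc_der (ps := pW) (DU v0))
  DUP (DV_der pV v0P va2 va4 va6)
  (DU_str pU v0P va2 va4 va6) (DV_str pV v0P va2 va4 va6)
  (DU_x pU v0P va2 va4 va6) (DU_y pU v0P va2 va4 va6)
  (DV_w pV v0P va2 va4 va6) (DV_t pV v0P va2 va4 va6)
  DWP DWE _ _
  (dual_basisU h2 disc1 pU) (dual_basisV h2 pV)
  (DU_dU v0P va2 va4 va6) (DV_dV v0P va2 va4 va6) (DV_b pV v0P va2 va4 va6)).
Qed.

Let dy : dU (chart_v pU) = polyU pU (cubicp a2 a4 a6)^`().
Proof. by rewrite dU_y deriv_cubicp (rmorph_dcubic (polyU pU)). Qed.

Let eta_val : @form_val (loc pW) (loc pW)^o dW (weier_eta pV pW h) = weier_x pW.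
Proof.
have [_ o1 _] := dbW.
by rewrite [LHS]form_val_mul1 [X in _ * X]o1 mulr1.
Qed.

Lemma weier_gauss_manin_unique (v : R -> R) (zw ze : cochain X) :
  torsion_free R ->
  second_kind_class (weier_omega pV pW h) zw ->
  second_kind_class (weier_eta pV pW h) ze ->
  gauss_manin v zw ze -> gauss_manin v ze (cochain0 X) ->
  [/\ v a2 = a4, v a4 = 6 * a6 & v a6 = 4 * a2 * a6 - a4 ^+ 2].
Proof.
move=> tf zwP zeP GMw GMe.
have [-> -> ->] := @gauss_manin_unique R X a2 a4 a6 (polyU pU) (chart_v pU)
  (fun=> erefl) (polyU_sqr pU) (@polyU_decomp R a2 a4 a6 pU)
  (@polyU_uniq R a2 a4 a6 pU) (dU (pU := pU)) dW (omegaU h di pU)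
  (weier_omega pV pW h) (weier_eta pV pW h) (dU_x pU) dy
  (dual_basisU h2 disc1 pU) dbW dWE eta_val (@weier_resU_inj R a2 a4 a6 pU pW) tf
  v0 (DU v0) DUP (DU_str pU v0P va2 va4 va6) (DU_x pU v0P va2 va4 va6)
  (DU_dU v0P va2 va4 va6) v zw ze zwP zeP GMw GMe.
by split.
Qed.

End WeierCurve.

(** * Localizations of polynomial rings *)

Lemma mderiv_derivation (A : comNzRingType) n (i : 'I_n) :
  @derivation {mpoly A[n]} {mpoly A[n]}^o (mderiv i).
Proof.
split=> p q; first exact: mderivD.
by rewrite mderivM addrC mulrC [in X in _ + X]mulrC mulrC [X in _ + X]mulrC.
Qed.

Lemma rmorph_loc_eq (A C : comNzRingType) (s : A) (ps : proper_gen (loc_rel s))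
    (f g : {rmorphism loc ps -> C}) :
  (forall a, f (inloc ps a) = g (inloc ps a)) -> f =1 g.
Proof.
move=> fg z; have [n [a Ea]] := loc_den z.
have gs : g (inloc ps s) * g (locinv ps) = 1 by rewrite -rmorphM mul_locinv rmorph1.
have: f (inloc ps s ^+ n * z) = g (inloc ps s ^+ n * z) by rewrite Ea fg.
rewrite [LHS]rmorphM [RHS]rmorphM !rmorphXn fg.
move=> /(congr1 (fun c => g (locinv ps) ^+ n * c)).
by rewrite !mulrA -!exprMn [g (locinv ps) * _]mulrC gs expr1n !mul1r.
Qed.

Lemma rmorph_int_eq (C : comNzRingType) (f g : {rmorphism int -> C}) : f =1 g.
Proof. by move=> z; rewrite -[z]intz !rmorph_int. Qed.

Lemma rmorph_mpoly_eq (A C : comNzRingType) n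
    (f g : {rmorphism {mpoly A[n]} -> C}) :
  (forall c, f c%:MP = g c%:MP) -> (forall i, f 'X_i = g 'X_i) -> f =1 g.
Proof.
move=> fgC fgX; elim/mpolyind=> [|c m p _ _ IH]; first by rewrite !rmorph0.
rewrite !rmorphD IH -mul_mpolyC [f (_ * _)]rmorphM [g (_ * _)]rmorphM fgC.
congr (_ * _ + _); rewrite mpolyXE_id !rmorph_prod; apply: eq_bigr => i _.
by rewrite !rmorphXn fgX.
Qed.

Definition loc_lift (A C : comNzRingType) (s : A) (ps : proper_gen (loc_rel s))
    (g : {rmorphism A -> C}) (u : C) (gs : g s * u = 1) : {rmorphism loc ps -> C} :=
  lift ps (ev_loc_rel gs).

Lemma loc_liftE (A C : comNzRingType) (s : A) (ps : proper_gen (loc_rel s))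
    (g : {rmorphism A -> C}) (u : C) (gs : g s * u = 1) a :
  loc_lift ps gs (inloc ps a) = g a.
Proof. by rewrite /loc_lift liftE evC. Qed.

Section LocMpoly.
Variables (A : comNzRingType) (n : nat) (s : {mpoly A[n]}).
Variable ps : proper_gen (loc_rel s).
Let L := loc ps.
Let cst (c : A) : L := inloc ps c%:MP.
Let var (i : 'I_n) : L := inloc ps 'X_i.

Definition partial (i : 'I_n) : L -> L := loc_der (ps := ps) (mderiv i).

Lemma partial_der i : @derivation L L^o (partial i).
Proof. exact: (loc_derP ps (mderiv_derivation A i)).1. Qed.

Lemma partial_cst i c : partial i (cst c) = 0.
Proof.
rewrite [LHS](loc_derP ps (mderiv_derivation A i)).2 mderivC.
exact: (rmorph0 (inloc ps)).
Qed.

Lemma partial_var i j : partial i (var j) = (i == j)%:R.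
Proof.
rewrite [LHS](loc_derP ps (mderiv_derivation A i)).2 mderivX mnm1E eq_sym.
case: eqP => [->|_]; last by rewrite scale0r (rmorph0 (inloc ps)).
have -> : (U_(j) - U_(j))%MM = 0%MM.
  by apply/mnmP => l; rewrite mnmBE mnm0E subnn.
by rewrite scale1r mpolyX0 (rmorph1 (inloc ps)).
Qed.

Lemma der_along_locmpoly0 (C : comNzRingType) (M : lmodType C)
    (phi : {rmorphism L -> C}) (D : L -> M) :
  der_along phi D -> (forall c, D (cst c) = 0) -> (forall i, D (var i) = 0) ->
  forall z, D z = 0.
Proof.
move=> DP Dc Dv; apply: (der_along_loc0 DP).
exact: (der_along_mpoly0 (der_along_comp (inloc ps) DP)).
Qed.

Lemma rmorph_locmpoly_eq (C : comNzRingType) (f g : {rmorphism L -> C}) :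
  (forall c, f (cst c) = g (cst c)) -> (forall i, f (var i) = g (var i)) -> f =1 g.
Proof.
move=> fgc fgv; apply: rmorph_loc_eq.
exact: (rmorph_mpoly_eq (f := f \o inloc ps) (g := g \o inloc ps)).
Qed.

Lemma locmpoly_lift (C : comNzRingType) (g : {rmorphism A -> C}) (X : 'I_n -> C) u :
  mmap g X s * u = 1 -> exists f : {rmorphism L -> C},
    (forall c, f (cst c) = g c) /\ (forall i, f (var i) = X i).
Proof.
move=> su; exists (loc_lift ps su); split=> a; rewrite [LHS]loc_liftE /=.
  exact: mmapC.
by rewrite mmapX mmap1U.
Qed.

End LocMpoly.

Lemma derivation_comb3 (A : comNzRingType) (c0 c1 c2 : A) (D0 D1 D2 : A -> A) :
  @derivation A A^o D0 -> @derivation A A^o D1 -> @derivation A A^o D2 ->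
  @derivation A A^o (fun a => c0 * D0 a + c1 * D1 a + c2 * D2 a).
Proof.
move=> P0 P1 P2; split=> a b; rewrite ?P0.1 ?P1.1 ?P2.1; first by ring.
by rewrite !(der_mul P0, der_mul P1, der_mul P2) -[_ *: _]/(_ * _)
  -[b *: _]/(_ * _); ring.
Qed.

Section Partial3.
Variables (A : comNzRingType) (s : {mpoly A[3]}) (ps : proper_gen (loc_rel s)).
Let L := loc ps.
Variables c0 c1 c2 : L.

Definition partial3 (a : L) : L :=
  c0 * partial o0 a + c1 * partial o1 a + c2 * partial o2 a.

Lemma partial3_der : @derivation L L^o partial3.
Proof.
apply: derivation_comb3; exact: partial_der.
Qed.

Lemma partial3_cst c : partial3 (inloc ps c%:MP) = 0.
Proof. by rewrite /partial3 !partial_cst !mulr0 !addr0. Qed.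

Lemma partial3_var :
  [/\ partial3 (inloc ps 'X_o0) = c0, partial3 (inloc ps 'X_o1) = c1
    & partial3 (inloc ps 'X_o2) = c2].
Proof.
by split; rewrite /partial3 !partial_var /= ?mulr0 ?mulr1 ?addr0 ?add0r.
Qed.

End Partial3.

Lemma ord3_ind (P : 'I_3 -> Prop) : P o0 -> P o1 -> P o2 -> forall i, P i.
Proof.
move=> P0 P1 P2 [[|[|[|//]]] lt_i].
- by rewrite (_ : Ordinal lt_i = o0) //; exact: val_inj.
- by rewrite (_ : Ordinal lt_i = o1) //; exact: val_inj.
- by rewrite (_ : Ordinal lt_i = o2) //; exact: val_inj.
Qed.

Lemma torsion_free_int : torsion_free int.
Proof. by move=> a n /eqP; rewrite Num.Theory.mulrn_eq0 => /eqP. Qed.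

Lemma torsion_free_B1 : torsion_free B1.
Proof.
exact: torsion_free_loc (torsion_free_mpoly (torsion_free_loc torsion_free_int)).
Qed.

(** * The Ramanujan vector field on B_1 *)

Section HalvedCoefficients.
Variables (A : comNzRingType) (h c2 c4 c6 : A).
Hypothesis h2 : 2 * h = 1.

Lemma cubic_disc_halved : cubic_disc (h ^+ 2 * c2) (h * c4) (h ^+ 2 * c6) =
  h ^+ 4 * disc h c2 c4 c6.
Proof.
have h0 : 2 * h - 1 = 0 by rewrite h2 subrr.
apply: (eq_mod (q := 4 * h ^+ 3 * c4 ^+ 3
  - (2 * h + 1) * h ^+ 6 * c2 ^+ 3 * c6 + 9 * h ^+ 4 * c2 * c4 * c6) h0).
by rewrite /cubic_disc /disc; ring.
Qed.

Lemma halved_halfK c : 4 * (h ^+ 2 * c) = c.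
Proof. by transitivity ((2 * h) ^+ 2 * c); [ring | rewrite h2 expr1n mul1r]. Qed.

Lemma half_doubleK c : 2 * (h * c) = c.
Proof. by rewrite mulrA h2 mul1r. Qed.

Variable v : A -> A.
Hypotheses (vP : @derivation A A^o v) (vh : v h = 0).

Lemma der_halved :
  [/\ v (h ^+ 2 * c2) = h ^+ 2 * v c2, v (h * c4) = h * v c4
    & v (h ^+ 2 * c6) = h ^+ 2 * v c6].
Proof. by split; rewrite (der_mul vP) ?(der_exp vP) vh !mulr0 addr0. Qed.

(** Rewrites the field from b2, b4, b6 into the Weierstrass coefficients b2/4, b4/2, b6/4, in which
    the lifts to the curve are written. *)
Lemma ramanujan_halved :
  v c2 = 2 * c4 -> v c4 = 3 * c6 -> v c6 = c2 * c6 - c4 ^+ 2 ->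
  [/\ v (h ^+ 2 * c2) = h * c4, v (h * c4) = 6 * (h ^+ 2 * c6)
    & v (h ^+ 2 * c6) = 4 * (h ^+ 2 * c2) * (h ^+ 2 * c6) - (h * c4) ^+ 2].
Proof.
have [-> -> ->] := der_halved => -> -> ->; split.
- by rewrite -[RHS]half_doubleK; ring.
- by rewrite -[LHS]half_doubleK; ring.
- by rewrite halved_halfK; ring.
Qed.

Lemma ramanujan_halved_inv :
  v (h ^+ 2 * c2) = h * c4 -> v (h * c4) = 6 * (h ^+ 2 * c6) ->
  v (h ^+ 2 * c6) = 4 * (h ^+ 2 * c2) * (h ^+ 2 * c6) - (h * c4) ^+ 2 ->
  [/\ v c2 = 2 * c4, v c4 = 3 * c6 & v c6 = c2 * c6 - c4 ^+ 2].
Proof.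
have [-> -> ->] := der_halved => E2 E4 E6; split.
- by rewrite -[LHS]halved_halfK E2 -{2}[c4]half_doubleK; ring.
- by rewrite -[LHS]half_doubleK E4 -{2}[c6]halved_halfK; ring.
- rewrite -[LHS]halved_halfK E6 halved_halfK -{2}[c6]halved_halfK.
  by rewrite -{2}[c4]half_doubleK; ring.
Qed.

End HalvedCoefficients.

Lemma half12P : 2 * half12 = 1.
Proof. by rewrite -[RHS](mul_locinv proper_2) (rmorph_nat (inloc proper_2)). Qed.

Lemma halfP : 2 * half = 1.
Proof.
have := congr1 B1_str half12P.
by rewrite (rmorphM B1_str) (rmorph_nat B1_str) (rmorph1 B1_str).
Qed.

Lemma Delta_B1 : inloc proper_Delta Delta = disc half b2 b4 b6.
Proof. exact: (rmorph_disc (inloc proper_Delta)). Qed.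

(** The cubic has discriminant Delta/16, hence the factor 16. *)
Lemma cubic_disc_B1 : cubic_disc a2 a4 a6 * (16 * locinv proper_Delta) = 1.
Proof.
rewrite [cubic_disc _ _ _](cubic_disc_halved b2 b4 b6 halfP) -Delta_B1.
transitivity ((2 * half) ^+ 4 * (inloc proper_Delta Delta * locinv proper_Delta)).
  by move: (inloc _ _) => D; ring.
by rewrite halfP mul_locinv expr1n mul1r.
Qed.

Definition ramanujan : B1 -> B1 :=
  partial3 (ps := proper_Delta) (2 * b4) (3 * b6) (b2 * b6 - b4 ^+ 2).

Lemma ramanujan_der : @derivation B1 B1^o ramanujan.
Proof. exact: partial3_der. Qed.

Lemma ramanujan_cst c : ramanujan (B1_str c) = 0.
Proof. exact: partial3_cst. Qed.

Lemma ramanujan_var : [/\ ramanujan b2 = 2 * b4, ramanujan b4 = 3 * b6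
  & ramanujan b6 = b2 * b6 - b4 ^+ 2].
Proof. exact: partial3_var. Qed.

Lemma ramanujan_a : [/\ ramanujan a2 = a4, ramanujan a4 = 6 * a6
  & ramanujan a6 = 4 * a2 * a6 - a4 ^+ 2].
Proof.
have [E2 E4 E6] := ramanujan_var.
exact: (ramanujan_halved halfP ramanujan_der (ramanujan_cst half12) E2 E4 E6).
Qed.

(** Uniqueness on the curve fixes v at a2, a4, a6, thus at b2, b4, b6; a derivation of [B1] killing
    Z[1/2] is determined by those values. *)
Lemma is_ramanujanP (v : B1 -> B1) : is_ramanujan v <-> v =1 ramanujan.
Proof.
have [E2 E4 E6] := ramanujan_a.
have RP := ramanujan_der.
split=> [[[vP v0] [zw [ze [zwP zeP GMw GMe]]]]|/funext ->]; last first.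
  split; first by split; [exact: RP | exact: ramanujan_cst].
  exact: (weier_gauss_manin halfP cubic_disc_B1 proper_V proper_W RP E2 E4 E6).
have [F2 F4 F6] := weier_gauss_manin_unique halfP cubic_disc_B1
  RP E2 E4 E6 torsion_free_B1 zwP zeP GMw GMe.
have [{}F2 {}F4 {}F6] := ramanujan_halved_inv halfP vP (v0 half12) F2 F4 F6.
have [{}E2 {}E4 {}E6] := ramanujan_var.
move=> z; apply/eqP; rewrite -subr_eq0; apply/eqP; move: z.
have EP := der_along_sub (phi := idfun) vP RP.
apply: (der_along_locmpoly0 (phi := idfun) EP) => [c|i].
  by rewrite [X in X - _]v0 [X in _ - X]ramanujan_cst subrr.
elim/ord3_ind: i.
- by rewrite [X in X - _]F2 [X in _ - X]E2 subrr.
- by rewrite [X in X - _]F4 [X in _ - X]E4 subrr.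
- by rewrite [X in X - _]F6 [X in _ - X]E6 subrr.
Qed.

(** * The change of variables to e_2, e_4, e_6 *)

Section EisensteinFormulas.
Variables (A : comNzRingType) (s : A).
Hypothesis s6 : 6 * s = 1.
Implicit Types c e : A.

Definition eis4 c2 c4 := c2 ^+ 2 - 24 * c4.
Definition eis6 c2 c4 c6 := c2 ^+ 3 - 36 * c2 * c4 + 216 * c6.
(** The inverse substitution with s = 1/6: the constants 9 s^3 and s^3 are 1/24 and 1/216. *)
Definition b4_of e2 e4 := 9 * s ^+ 3 * (e2 ^+ 2 - e4).
Definition b6_of e2 e4 e6 := s ^+ 3 * (e6 - e2 ^+ 3 + 36 * e2 * b4_of e2 e4).

Let s216 : 216 * s ^+ 3 - 1 = 0.
Proof.
have -> : 216 * s ^+ 3 = (6 * s) ^+ 3 by ring.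
by rewrite s6 expr1n subrr.
Qed.

Lemma eis4K c2 c4 : b4_of c2 (eis4 c2 c4) = c4.
Proof. by apply: (eq_mod (q := c4) s216); rewrite /b4_of /eis4; ring. Qed.

Lemma eis6K c2 c4 c6 : b6_of c2 (eis4 c2 c4) (eis6 c2 c4 c6) = c6.
Proof.
rewrite /b6_of eis4K; apply: (eq_mod (q := c6) s216).
by rewrite /eis6; ring.
Qed.

Lemma b4_ofK e2 e4 : eis4 e2 (b4_of e2 e4) = e4.
Proof.
by apply: (eq_mod (q := e4 - e2 ^+ 2) s216); rewrite /b4_of /eis4; ring.
Qed.

Lemma b6_ofK e2 e4 e6 : eis6 e2 (b4_of e2 e4) (b6_of e2 e4 e6) = e6.
Proof.
apply: (eq_mod (q := e6 - e2 ^+ 3 + 36 * e2 * b4_of e2 e4) s216).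
by rewrite /b6_of; move: (b4_of _ _) => c4; rewrite /eis6; ring.
Qed.

Lemma disc_eis h c2 c4 c6 : 2 * h = 1 ->
  eis4 c2 c4 ^+ 3 - eis6 c2 c4 c6 ^+ 2 = 1728 * disc h c2 c4 c6.
Proof.
move=> h2; have h0 : 2 * h - 1 = 0 by rewrite h2 subrr.
apply: (eq_mod (q := - 432 * (2 * h + 1) * (c2 ^+ 2 * (c4 ^+ 2 - c2 * c6))) h0).
by rewrite /eis4 /eis6 /disc; ring.
Qed.

Lemma s1728 : 1728 * (27 * s ^+ 6) = 1.
Proof.
have -> : 1728 * (27 * s ^+ 6) = (6 * s) ^+ 6 by ring.
by rewrite s6 expr1n.
Qed.

(* The right-hand sides of the classical Ramanujan equations, with s = 1/6. *)
Lemma ramanujan_eis c2 c4 c6 :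
  [/\ 3 * s * s * (c2 ^+ 2 - eis4 c2 c4) = 2 * c4,
      2 * s * (c2 * eis4 c2 c4 - eis6 c2 c4 c6) = 2 * c2 * (2 * c4) - 24 * (3 * c6)
    & 3 * s * (c2 * eis6 c2 c4 c6 - eis4 c2 c4 ^+ 2) =
      3 * c2 ^+ 2 * (2 * c4) - 36 * (c2 * (3 * c6) + c4 * (2 * c4))
      + 216 * (c2 * c6 - c4 ^+ 2)].
Proof.
have s0 : 6 * s - 1 = 0 by rewrite s6 subrr.
rewrite /eis4 /eis6; split.
- by apply: (eq_mod (q := 2 * c4 * (6 * s + 1)) s0); ring.
- by apply: (eq_mod (q := 4 * c2 * c4 - 72 * c6) s0); ring.
- by apply: (eq_mod (q := 6 * c2 ^+ 2 * c4 + 108 * c2 * c6 - 288 * c4 ^+ 2) s0); ring.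
Qed.

Lemma eis_der (v : A -> A) : @derivation A A^o v -> forall c2 c4 c6,
  v (eis4 c2 c4) = 2 * c2 * v c2 - 24 * v c4 /\
  v (eis6 c2 c4 c6) = 3 * c2 ^+ 2 * v c2 - 36 * (c2 * v c4 + c4 * v c2) + 216 * v c6.
Proof.
move=> vP c2 c4 c6; rewrite /eis4 /eis6 !(derE vP); split; ring.
Qed.

End EisensteinFormulas.

Section EisensteinMorph.
Variables (A A' : comNzRingType) (f : {rmorphism A -> A'}).

Lemma rmorph_eis4 c2 c4 : f (eis4 c2 c4) = eis4 (f c2) (f c4).
Proof. rewrite /eis4; ring. Qed.
Lemma rmorph_eis6 c2 c4 c6 : f (eis6 c2 c4 c6) = eis6 (f c2) (f c4) (f c6).
Proof. rewrite /eis6; ring. Qed.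
Lemma rmorph_b4_of s e2 e4 : f (b4_of s e2 e4) = b4_of (f s) (f e2) (f e4).
Proof. rewrite /b4_of; ring. Qed.
Lemma rmorph_b6_of s e2 e4 e6 :
  f (b6_of s e2 e4 e6) = b6_of (f s) (f e2) (f e4) (f e6).
Proof. by rewrite /b6_of -rmorph_b4_of; move: (b4_of _ _ _) => c; ring. Qed.

End EisensteinMorph.

(** Localizations of Z admit at most one morphism to any ring, which settles the constants when the
    two composites are compared with the identity. *)
Lemma rmorph_locint_eq (C : comNzRingType) (m : int) (pm : proper_gen (loc_rel m))
    (f g : {rmorphism loc pm -> C}) : f =1 g.
Proof.
apply: rmorph_loc_eq => a.
exact: (rmorph_int_eq (f \o inloc pm) (g \o inloc pm)).
Qed.

Definition loc_nat_lift (C : comNzRingType) n (pn : proper_gen (loc_rel (n%:R : int)))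
    (u : C) (nu : n%:R * u = 1) : {rmorphism loc pn -> C} :=
  loc_lift pn (g := (intr : {rmorphism int -> C}))
    (etrans (congr1 (fun a => a * u) (rmorph_nat (intr : {rmorphism int -> C}) n)) nu).

Lemma inv_uniq (C : comNzRingType) (a u w : C) : a * u = 1 -> a * w = 1 -> u = w.
Proof. by move=> au aw; rewrite -[u]mulr1 -aw mulrA [u * a]mulrC au mul1r. Qed.

Definition sixthB : B1_6 := toB1_6 half * locinv proper_3.

Lemma sixthB_P : 6 * sixthB = 1.
Proof.
have E3 : 3 * locinv proper_3 = 1.
  by rewrite -[RHS](mul_locinv proper_3) (rmorph_nat (inloc proper_3)).
have E2 : 2 * toB1_6 half = 1.
  have := congr1 toB1_6 halfP.
  by rewrite (rmorphM toB1_6) (rmorph_nat toB1_6) (rmorph1 toB1_6).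
rewrite /sixthB; move: (toB1_6 half) (locinv proper_3) E2 E3 => a b E2 E3.
transitivity ((2 * a) * (3 * b)); first by ring.
by rewrite E2 E3 mulr1.
Qed.

Lemma sixthP : 6 * sixth = 1.
Proof.
have E : 6 * sixth16 = 1.
  by rewrite -[RHS](mul_locinv proper_6) (rmorph_nat (inloc proper_6)).
have := congr1 (inloc proper_e \o (@mpolyC 3 Z16 : {rmorphism Z16 -> Z16e})) E.
by rewrite rmorphM rmorph_nat rmorph1.
Qed.

Lemma third_E1 : 3 * (2 * sixth) = 1.
Proof. by rewrite -[RHS]sixthP; move: sixth => s; ring. Qed.

Lemma half_E1 : 2 * (3 * sixth) = 1.
Proof. by rewrite -[RHS]sixthP; move: sixth => s; ring. Qed.

Lemma discB1_unit : disc half b2 b4 b6 * locinv proper_Delta = 1.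
Proof. by rewrite -Delta_B1 mul_locinv. Qed.

Lemma disc_e_E1 : (e4 ^+ 3 - e6 ^+ 2) * locinv proper_e = 1.
Proof.
rewrite -(mul_locinv proper_e); congr (_ * _).
by rewrite (rmorphB (inloc proper_e)) !(rmorphXn (inloc proper_e)).
Qed.

Definition val3 (T : Type) (x0 x1 x2 : T) (i : 'I_3) : T :=
  if i == o0 then x0 else if i == o1 then x1 else x2.

Lemma eisenstein_mor : exists phi : {rmorphism E1 -> B1_6},
  [/\ phi e2 = toB1_6 b2, phi e4 = eis4 (toB1_6 b2) (toB1_6 b4)
    & phi e6 = eis6 (toB1_6 b2) (toB1_6 b4) (toB1_6 b6)].
Proof.
pose g := loc_nat_lift proper_6 sixthB_P.
pose c4 := eis4 (toB1_6 b2) (toB1_6 b4).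
pose c6 := eis6 (toB1_6 b2) (toB1_6 b4) (toB1_6 b6).
pose X := val3 (toB1_6 b2) c4 c6.
have gX : mmap g X disc_e = c4 ^+ 3 - c6 ^+ 2.
  by rewrite /disc_e rmorphB !rmorphXn /= !mmapX !mmap1U.
have h2 : 2 * toB1_6 half = 1.
  have := congr1 toB1_6 halfP.
  by rewrite (rmorphM toB1_6) (rmorph_nat toB1_6) (rmorph1 toB1_6).
have D1 : disc (toB1_6 half) (toB1_6 b2) (toB1_6 b4) (toB1_6 b6)
    * toB1_6 (locinv proper_Delta) = 1.
  by rewrite -(rmorph_disc toB1_6) -(rmorphM toB1_6) discB1_unit (rmorph1 toB1_6).
(* As e4^3 - e6^2 = 1728 Delta and 1728 * 27 = 6^6, the inverse is 27 s^6 / Delta. *)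
have inv : mmap g X disc_e * (27 * sixthB ^+ 6 * toB1_6 (locinv proper_Delta)) = 1.
  rewrite gX [_ - _](disc_eis (toB1_6 b2) (toB1_6 b4) (toB1_6 b6) h2).
  move: D1; set D := disc _ _ _ _; move: (toB1_6 (locinv _)) => u D1.
  transitivity (1728 * (27 * sixthB ^+ 6) * (D * u)).
    by move: sixthB => s; ring.
  by rewrite (s1728 sixthB_P) D1 mulr1.
have [phi [_ phiX]] := locmpoly_lift proper_e inv.
by exists phi; split; [rewrite [LHS](phiX o0) | rewrite [LHS](phiX o1) |
  rewrite [LHS](phiX o2)].
Qed.

Lemma eisenstein_mor_inv : exists psi : {rmorphism B1_6 -> E1},
  [/\ psi (toB1_6 b2) = e2, psi (toB1_6 b4) = b4_of sixth e2 e4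
    & psi (toB1_6 b6) = b6_of sixth e2 e4 e6].
Proof.
pose g := loc_nat_lift proper_2 half_E1.
pose c4 := b4_of sixth e2 e4.
pose c6 := b6_of sixth e2 e4 e6.
pose Y := val3 e2 c4 c6.
have gh : 2 * g half12 = 1.
  have := congr1 g half12P.
  by rewrite (rmorphM g) (rmorph_nat g) (rmorph1 g).
have gY : mmap g Y Delta = disc (g half12) e2 c4 c6.
  rewrite /Delta rmorph_disc /=; congr disc; first exact: mmapC.
  - by rewrite mmapX mmap1U.
  - by rewrite mmapX mmap1U.
  - by rewrite mmapX mmap1U.
have inv : mmap g Y Delta * (1728 * locinv proper_e) = 1.
  rewrite gY mulrCA mulrA -(disc_eis e2 c4 c6 gh).
  by rewrite (b4_ofK sixthP) (b6_ofK sixthP) disc_e_E1.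
have [psi1 [_ psiY]] := locmpoly_lift proper_Delta inv.
have inv3 : psi1 3 * (2 * sixth) = 1 by rewrite (rmorph_nat psi1) third_E1.
exists (loc_lift proper_3 inv3); split; rewrite [LHS]loc_liftE.
- by rewrite [LHS](psiY o0).
- by rewrite [LHS](psiY o1).
- by rewrite [LHS](psiY o2).
Qed.

Lemma eis_cancel (A A' : comNzRingType) (f : {rmorphism A -> A'})
    (g : {rmorphism A' -> A}) (s x2 x4 x6 : A) (s' c2 c4 c6 : A') :
  6 * s = 1 -> 6 * s' = 1 ->
  f x2 = c2 -> f x4 = eis4 c2 c4 -> f x6 = eis6 c2 c4 c6 -> f s = s' ->
  g c2 = x2 -> g c4 = b4_of s x2 x4 -> g c6 = b6_of s x2 x4 x6 ->
  [/\ g (f x2) = x2, g (f x4) = x4 & g (f x6) = x6] /\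
  [/\ f (g c2) = c2, f (g c4) = c4 & f (g c6) = c6].
Proof.
move=> s6 s6' f2 f4 f6 fs g2 g4 g6; split; split.
- by rewrite f2.
- by rewrite f4 rmorph_eis4 g2 g4 b4_ofK.
- by rewrite f6 rmorph_eis6 g2 g4 g6 b6_ofK.
- by rewrite g2.
- by rewrite g4 rmorph_b4_of fs f2 f4 eis4K.
- by rewrite g6 rmorph_b6_of fs f2 f4 f6 eis6K.
Qed.

Lemma eisenstein_iso : exists phi : {rmorphism E1 -> B1_6},
  [/\ bijective phi, phi e2 = toB1_6 b2, phi e4 = eis4 (toB1_6 b2) (toB1_6 b4)
    & phi e6 = eis6 (toB1_6 b2) (toB1_6 b4) (toB1_6 b6)].
Proof.
have [phi [p2 p4 p6]] := eisenstein_mor; exists phi; split=> //.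
have [psi [q2 q4 q6]] := eisenstein_mor_inv.
have ps : phi sixth = sixthB.
  apply: (@inv_uniq _ 6); last exact: sixthB_P.
  by rewrite -(rmorph_nat phi) -(rmorphM phi) sixthP (rmorph1 phi).
have [[k2 k4 k6] [l2 l4 l6]] :=
  eis_cancel sixthP sixthB_P p2 p4 p6 ps q2 q4 q6.
exists psi.
  apply: (rmorph_locmpoly_eq (f := psi \o phi) (g := idfun)) => [c|].
    exact: (rmorph_locint_eq
      (psi \o phi \o inloc proper_e \o (@mpolyC 3 Z16 : {rmorphism Z16 -> Z16e}))
      (inloc proper_e \o (@mpolyC 3 Z16 : {rmorphism Z16 -> Z16e}))).
  by apply: ord3_ind; [exact: k2 | exact: k4 | exact: k6].
apply: (rmorph_loc_eq (f := phi \o psi) (g := idfun)).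
apply: (rmorph_locmpoly_eq (f := phi \o psi \o toB1_6) (g := toB1_6)) => [c|].
  exact: (rmorph_locint_eq (phi \o psi \o toB1_6 \o B1_str) (toB1_6 \o B1_str)).
by apply: ord3_ind; [exact: l2 | exact: l4 | exact: l6].
Qed.

Definition ramanujan_e : E1 -> E1 :=
  partial3 (ps := proper_e) (3 * sixth * sixth * (e2 ^+ 2 - e4))
    (2 * sixth * (e2 * e4 - e6)) (3 * sixth * (e2 * e6 - e4 ^+ 2)).

Lemma eis_intertwine (A B C : comNzRingType) (f : {rmorphism A -> C})
    (g : {rmorphism B -> C}) (w : A -> A) (v : B -> B) (V : C -> C)
    (s x2 x4 x6 : A) (s' : C) (c2 c4 c6 : B) :
  6 * s' = 1 -> f s = s' ->
  @derivation C C^o V -> (forall b, V (g b) = g (v b)) ->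
  f x2 = g c2 -> f x4 = eis4 (g c2) (g c4) -> f x6 = eis6 (g c2) (g c4) (g c6) ->
  [/\ w x2 = 3 * s * s * (x2 ^+ 2 - x4), w x4 = 2 * s * (x2 * x4 - x6)
    & w x6 = 3 * s * (x2 * x6 - x4 ^+ 2)] ->
  [/\ v c2 = 2 * c4, v c4 = 3 * c6 & v c6 = c2 * c6 - c4 ^+ 2] ->
  [/\ f (w x2) - V (f x2) = 0, f (w x4) - V (f x4) = 0 & f (w x6) - V (f x6) = 0].
Proof.
move=> s6 fs VP Vg f2 f4 f6 [-> -> ->] [v2 v4 v6].
have [V4 V6] := eis_der VP (g c2) (g c4) (g c6).
have [R2 R4 R6] := ramanujan_eis s6 (g c2) (g c4) (g c6).
have V2' : V (g c2) = 2 * g c4 by rewrite Vg v2; ring.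
have V4' : V (g c4) = 3 * g c6 by rewrite Vg v4; ring.
have V6' : V (g c6) = g c2 * g c6 - g c4 ^+ 2 by rewrite Vg v6; ring.
have fE x y z : [/\
    f (3 * s * s * (x ^+ 2 - y)) = 3 * f s * f s * (f x ^+ 2 - f y),
    f (2 * s * (x * y - z)) = 2 * f s * (f x * f y - f z)
  & f (3 * s * (x * z - y ^+ 2)) = 3 * f s * (f x * f z - f y ^+ 2)].
  by split; ring.
have [-> -> ->] := fE x2 x4 x6; rewrite fs f2 f4 f6 R2 R4 R6 V4 V6 V2' V4' V6'.
by rewrite !subrr.
Qed.

(** The difference of the two sides is a derivation along phi. It kills Z, hence Z[1/6], and on e2,
    e4, e6 it vanishes by the chain rule computation [eis_intertwine]. *)
Lemma eisenstein_ramanujan (phi : {rmorphism E1 -> B1_6}) :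
  phi e2 = toB1_6 b2 -> phi e4 = eis4 (toB1_6 b2) (toB1_6 b4) ->
  phi e6 = eis6 (toB1_6 b2) (toB1_6 b4) (toB1_6 b6) ->
  forall a, phi (ramanujan_e a) = base_change_6 ramanujan (phi a).
Proof.
move=> p2 p4 p6.
have [VP VE] := loc_derP proper_3 ramanujan_der.
have ps : phi sixth = sixthB.
  apply: (@inv_uniq _ 6); last exact: sixthB_P.
  by rewrite -(rmorph_nat phi) -(rmorphM phi) sixthP (rmorph1 phi).
have [K2 K4 K6] := eis_intertwine sixthB_P ps VP VE p2 p4 p6
  (@partial3_var Z16 disc_e proper_e
    (3 * sixth * sixth * (e2 ^+ 2 - e4)) (2 * sixth * (e2 * e4 - e6))
    (3 * sixth * (e2 * e6 - e4 ^+ 2))) ramanujan_var.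
have EP := der_along_sub (phi := phi)
  (der_along_post phi (phi := idfun) (partial3_der
     (3 * sixth * sixth * (e2 ^+ 2 - e4)) (2 * sixth * (e2 * e4 - e6))
     (3 * sixth * (e2 * e6 - e4 ^+ 2))))
  (der_along_comp phi VP).
move=> a; apply/eqP; rewrite -subr_eq0; apply/eqP; move: a.
apply: (der_along_locmpoly0 EP) => [c|i].
  pose cst := inloc proper_e \o (@mpolyC 3 Z16 : {rmorphism Z16 -> Z16e}).
  move: c; apply: (der_along_loc0 (der_along_comp cst EP)).
  exact: (der_along_int0 (der_along_comp (inloc proper_6) (der_along_comp cst EP))).
by move: i; apply: ord3_ind; [exact: K2 | exact: K4 | exact: K6].
Qed.

Theorem mainTheorem7 :
  let v11 : B1 -> B1 := fun a =>
    2 * b4 * ddb o0 a + 3 * b6 * ddb o1 a + (b2 * b6 - b4 ^+ 2) * ddb o2 a in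
  let half_e : E1 := 3 * sixth in
  let third_e : E1 := 2 * sixth in
  let twelfth_e : E1 := half_e * sixth in
  let vE : E1 -> E1 := fun a =>
    twelfth_e * (e2 ^+ 2 - e4) * dde o0 a
    + third_e * (e2 * e4 - e6) * dde o1 a
    + half_e * (e2 * e6 - e4 ^+ 2) * dde o2 a in
  (forall v : B1 -> B1, is_ramanujan v <-> v =1 v11) /\
  exists phi : {rmorphism E1 -> B1_6},
    [/\ bijective phi,
        phi e2 = toB1_6 b2,
        phi e4 = toB1_6 (b2 ^+ 2 - 24 * b4),
        phi e6 = toB1_6 (b2 ^+ 3 - 36 * b2 * b4 + 216 * b6)
      & forall a : E1, phi (vE a) = base_change_6 v11 (phi a)].
Proof.
move=> v11 half_e third_e twelfth_e vE; split; first exact: is_ramanujanP.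
have [phi [phi_bij p2 p4 p6]] := eisenstein_iso; exists phi; split=> //.
- by rewrite [RHS](rmorph_eis4 toB1_6).
- by rewrite [RHS](rmorph_eis6 toB1_6).
- exact: eisenstein_ramanujan.
Qed.
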